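(* Let $M\in\mathcal{A}$, let $\sigma\in\Sigma_n(M)$ and let $\{v\}\in\mathsf{Face}_0\,\mathrm{N}(M)$ be the corresponding vertex. (a) $\mathsf{Facet}\,\sigma=\mathsf{Facet}^+\sigma\sqcup\mathsf{Facet}^-\sigma$. (b) $\partial^+\sigma=\bigcup_{\tau\in\mathsf{Facet}^+\sigma}\tau$ and $\partial^-\sigma=\bigcup_{\tau\in\mathsf{Facet}^-\sigma}\tau$. (c) Let $\sigma'\in\Sigma_n(M)$ be such that $\tau:=\sigma\cap\sigma'\in\mathsf{Facet}\,\sigma$, and let $\{v'\}\in\mathsf{Face}_0\,\mathrm{N}(M)$ be the vertex corresponding to $\sigma'$. Then precisely one of the following statements holds: (i) $v>v'$ and $\tau\in\mathsf{Facet}^+\sigma$; (ii) $v<v'$ and $\tau\in\mathsf{Facet}^-\sigma$.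
   Context: $\mathcal{A}$ is an abelian length category (every object has finite length) with only finitely many isoclasses $S(1),\ldots,S(n)$ of simple objects. $K_0(\mathcal{A})_{\mathbb{R}}=K_0(\mathcal{A})\otimes_{\mathbb{Z}}\mathbb{R}=\bigoplus_{i=1}^n\mathbb{R}[S(i)]\simeq\mathbb{R}^n$, and $K_0(\mathcal{A})_{\mathbb{R}}^*=\operatorname{Hom}_{\mathbb{R}}(K_0(\mathcal{A})_{\mathbb{R}},\mathbb{R})\simeq\mathbb{R}^n$ with the Euclidean topology. For $\theta\in K_0(\mathcal{A})_{\mathbb{R}}^*$ and $X\in\mathcal{A}$, write $\theta(X):=\theta([X])$. Partial order on $K_0(\mathcal{A})_{\mathbb{R}}$: $v\le v'$ iff $v'-v\in\sum_{i=1}^n\mathbb{R}_{\ge0}[S(i)]$; $v<v'$ means $v\le v'$ and $v\ne v'$. Semistable torsion pairs. For $\theta\in K_0(\mathcal{A})_{\mathbb{R}}^*$ define full subcategories of $\mathcal{A}$: $\overline{\mathcal{T}}_\theta$ = objects $X$ with $\theta(N)\ge0$ for every factor object $N$ of $X$; $\mathcal{F}_\theta$ = objects $X$ with $\theta(L)<0$ for every nonzero subobject $L$ of $X$; $\mathcal{T}_\theta$ = objects $X$ with $\theta(N)>0$ for every nonzero factor object $N$ of $X$; $\overline{\mathcal{F}}_\theta$ = objects $X$ with $\theta(L)\le0$ for every subobject $L$ of $X$. Then $(\overline{\mathcal{T}}_\theta,\mathcal{F}_\theta)$ and $(\mathcal{T}_\theta,\overline{\mathcal{F}}_\theta)$ are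 torsion pairs, and $\mathcal{W}_\theta:=\overline{\mathcal{T}}_\theta\cap\overline{\mathcal{F}}_\theta$ is an abelian category of finite length. For $M\in\mathcal{A}$, $\overline{\mathrm{t}}_\theta M$ (resp. $\mathrm{t}_\theta M$) is the largest subobject of $M$ lying in $\overline{\mathcal{T}}_\theta$ (resp. $\mathcal{T}_\theta$), $\mathrm{f}_\theta M:=M/\overline{\mathrm{t}}_\theta M$, $\overline{\mathrm{f}}_\theta M:=M/\mathrm{t}_\theta M$, $\mathrm{w}_\theta M:=\overline{\mathrm{t}}_\theta M/\mathrm{t}_\theta M\in\mathcal{W}_\theta$. For $X\in\mathcal{W}_\theta$, $\mathsf{supp}_\theta X$ is the set of isoclasses of composition factors of $X$ in $\mathcal{W}_\theta$. $M$-TF equivalence. $\theta,\eta\in K_0(\mathcal{A})_{\mathbb{R}}^*$ are $M$-TF equivalent if (i) $\mathrm{t}_\theta M=\mathrm{t}_\eta M$, $\mathrm{w}_\theta M=\mathrm{w}_\eta M$, $\mathrm{f}_\theta M=\mathrm{f}_\eta M$ (equivalently $\mathrm{t}_\theta M=\mathrm{t}_\eta M$ and $\overline{\mathrm{t}}_\theta M=\overline{\mathrm{t}}_\eta M$ as subobjects of $M$), and (ii) $\mathsf{supp}_\theta(\mathrm{w}_\theta M)=\mathsf{supp}_\eta(\mathrm{w}_\eta M)$. $\Sigma(M)$ is the set of closures of $M$-TF equivalence classes; it is a finite complete rational generalized fan (a set of polyhedral cones, not necessarily strongly convex, closed under faces and with pairwise intersections being common faces), and for each $\sigma\in\Sigma(M)$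 the relative interior $\sigma^\circ$ is an $M$-TF equivalence class. $\Sigma_n(M)$ is the set of $n$-dimensional (= maximal) cones of $\Sigma(M)$. Newton polytope: $\mathrm{N}(M):=\mathsf{conv}\{[X]\mid X\text{ is a subobject of }M\}\subset K_0(\mathcal{A})_{\mathbb{R}}$; $\mathsf{Face}_0\,\mathrm{N}(M)$ is its set of vertices. The vertex corresponding to $\sigma\in\Sigma_n(M)$ is $\{v\}=\mathrm{N}(M)_\theta:=\{u\in\mathrm{N}(M)\mid\theta(u)=\max\theta(\mathrm{N}(M))\}$ for any $\theta\in\sigma^\circ$; this gives a bijection between $\Sigma_n(M)$ and $\mathsf{Face}_0\,\mathrm{N}(M)$. For $\sigma\in\Sigma_n(M)$, put $\mathrm{t}_\sigma M:=\mathrm{t}_\theta M$ and $\mathrm{f}_\sigma M:=\mathrm{f}_\theta M$ for any $\theta\in\sigma^\circ$, and $\partial^+\sigma:=\{\theta\in\sigma\mid\mathrm{t}_\sigma M\notin\mathcal{T}_\theta\}$, $\partial^-\sigma:=\{\theta\in\sigma\mid\mathrm{f}_\sigma M\notin\mathcal{F}_\theta\}$. $\mathsf{Facet}\,\sigma$ is the set of facets (codimension one faces) of $\sigma$, and $\mathsf{Facet}^{\pm}\sigma:=\{\tau\in\mathsf{Facet}\,\sigma\mid\tau\subset\partial^{\pm}\sigma\}$. *)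

(* Defs.v *)
From HB Require Import structures.
From mathcomp Require Import all_boot all_order all_algebra.
From mathcomp Require Import boolp classical_sets reals topology normedtype.

Set Implicit Arguments.
Unset Strict Implicit.
Unset Printing Implicit Defensive.

Import Order.TTheory GRing.Theory Num.Theory.
Import numFieldNormedType.Exports.
Local Open Scope classical_set_scope.
Local Open Scope ring_scope.

(* Preadditive categories. Notions such as monomorphism, simple object and
   composition series are stated at this level so that they also make sense
   inside a full subcategory, without first knowing that it is abelian. *)
Record preadditive := Preadditive {
  obj :> Type;
  hom : obj -> obj -> zmodType;
  idm : forall X, hom X X;
  comp : forall X Y Z, hom Y Z -> hom X Y -> hom X Z;
  comp1m : forall X Y (f : hom X Y), comp (idm Y) f = f;
  compm1 : forall X Y (f : hom X Y), comp f (idm X) = f;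
  compA : forall X Y Z T (h : hom Z T) (g : hom Y Z) (f : hom X Y),
    comp h (comp g f) = comp (comp h g) f;
  compDl : forall X Y Z (g g' : hom Y Z) (f : hom X Y),
    comp (g + g') f = comp g f + comp g' f;
  compDr : forall X Y Z (g : hom Y Z) (f f' : hom X Y),
    comp g (f + f') = comp g f + comp g f'
}.

Definition full_subcat (C : preadditive) (P : C -> Prop) : preadditive :=
  @Preadditive {X : C | P X} (fun X Y => hom (sval X) (sval Y))
    (fun X => idm (sval X)) (fun X Y Z => @comp C (sval X) (sval Y) (sval Z))
    (fun X Y => @comp1m C (sval X) (sval Y))
    (fun X Y => @compm1 C (sval X) (sval Y))
    (fun X Y Z T => @compA C (sval X) (sval Y) (sval Z) (sval T))
    (fun X Y Z => @compDl C (sval X) (sval Y) (sval Z))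
    (fun X Y Z => @compDr C (sval X) (sval Y) (sval Z)).

Section Preadditive.
Variable C : preadditive.
Implicit Types X Y Z K Q L N S : C.

Definition is_zero X :=
  forall Y, (forall f : hom X Y, f = 0) /\ (forall g : hom Y X, g = 0).

Definition is_mono X Y (f : hom X Y) :=
  forall Z (g h : hom Z X), comp f g = comp f h -> g = h.

Definition is_epi X Y (f : hom X Y) :=
  forall Z (g h : hom Y Z), comp g f = comp h f -> g = h.

Definition is_iso X Y (f : hom X Y) :=
  exists g : hom Y X, comp g f = idm X /\ comp f g = idm Y.

Definition isomorphic X Y := exists f : hom X Y, is_iso f.

Definition is_kernel X Y K (f : hom X Y) (k : hom K X) :=
  comp f k = 0 /\
  forall Z (h : hom Z X), comp f h = 0 -> exists! u : hom Z K, comp k u = h.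

Definition is_cokernel X Y Q (f : hom X Y) (q : hom Y Q) :=
  comp q f = 0 /\
  forall Z (h : hom Y Z), comp h f = 0 -> exists! u : hom Q Z, comp u q = h.

Definition is_biproduct X Y Z (i1 : hom X Z) (i2 : hom Y Z)
    (p1 : hom Z X) (p2 : hom Z Y) :=
  [/\ comp p1 i1 = idm X, comp p2 i2 = idm Y, comp p1 i2 = 0, comp p2 i1 = 0
    & comp i1 p1 + comp i2 p2 = idm Z].

(* 0 -> X -> Y -> Z -> 0 is exact *)
Definition short_exact X Y Z (f : hom X Y) (g : hom Y Z) :=
  is_kernel g f /\ is_cokernel f g.

Definition simple_object S :=
  ~ is_zero S /\
  forall L (i : hom L S), is_mono i -> is_zero L \/ is_iso i.

(* [comp_series X s]: X has a composition series whose successive factors,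
   listed from the top, are the objects of s. *)
Inductive comp_series : C -> seq C -> Prop :=
| CompSeries0 X : is_zero X -> comp_series X [::]
| CompSeriesS X Y S (f : hom X Y) (g : hom Y S) s :
    short_exact f g -> simple_object S -> comp_series X s ->
    comp_series Y (S :: s).

Definition finite_length X := exists s, comp_series X s.

Definition comp_factor X S :=
  exists s, comp_series X s /\ has (fun S' => `[< isomorphic S' S >]) s.

(* Subobjects of M are represented by monomorphisms into M; equality of
   subobjects is [sub_eq], not Leibniz equality of representatives. *)
Record subobject (M : C) := Subobject {
  sub_dom : C;
  sub_arr : hom sub_dom M;
  sub_mono : is_mono sub_arr
}.

Definition sub_le (M : C) (U V : subobject M) :=
  exists h : hom (sub_dom U) (sub_dom V), comp (sub_arr V) h = sub_arr U.

Definition sub_eq (M : C) (U V : subobject M) := sub_le U V /\ sub_le V U.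

(* The inclusion U -> V when U <= V (and 0 otherwise). *)
Definition sub_incl (M : C) (U V : subobject M)
    : hom (sub_dom U) (sub_dom V) :=
  xget 0 [set h | comp (sub_arr V) h = sub_arr U].

Lemma idm_mono X : is_mono (idm X).
Proof. by move=> Z g h; rewrite !comp1m. Qed.

Definition is_largest_sub (P : C -> Prop) (M : C) (U : subobject M) :=
  P (sub_dom U) /\ forall V : subobject M, P (sub_dom V) -> sub_le V U.

(* The largest subobject of M lying in P, when there is one (the default value
   M is used otherwise). *)
Definition largest_sub (P : C -> Prop) (M : C) : subobject M :=
  @xget {classic subobject M} (Subobject (idm_mono (X := M)))
    [set U | is_largest_sub P U].

End Preadditive.

Record abelian_cat := AbelianCat {
  ab_cat :> preadditive;
  has_zero : exists Z : ab_cat, is_zero Z;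
  has_biproduct : forall X Y : ab_cat, exists (Z : ab_cat)
    (i1 : hom X Z) (i2 : hom Y Z) (p1 : hom Z X) (p2 : hom Z Y),
    is_biproduct i1 i2 p1 p2;
  has_kernel : forall (X Y : ab_cat) (f : hom X Y),
    exists (K : ab_cat) (k : hom K X), is_kernel f k;
  has_cokernel : forall (X Y : ab_cat) (f : hom X Y),
    exists (Q : ab_cat) (q : hom Y Q), is_cokernel f q;
  mono_normal : forall (X Y : ab_cat) (f : hom X Y), is_mono f ->
    exists (Z : ab_cat) (g : hom Y Z), is_kernel g f;
  epi_normal : forall (X Y : ab_cat) (f : hom X Y), is_epi f ->
    exists (Z : ab_cat) (g : hom Z X), is_cokernel g f
}.

(* The object Y/X = Coker f. *)
Definition coker (A : abelian_cat) (X Y : A) (f : hom X Y) : A :=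
  sval (cid (has_cokernel f)).

(* Abelian length categories together with representatives S(1), ..., S(n) of
   their isoclasses of simple objects. *)
Record length_cat (n : nat) := LengthCat {
  len_cat :> abelian_cat;
  all_finite_length : forall X : len_cat, finite_length X;
  simp : 'I_n -> len_cat;
  simp_simple : forall i, simple_object (simp i);
  simp_inj : forall i j, isomorphic (simp i) (simp j) -> i = j;
  simp_all : forall S : len_cat, simple_object S ->
    exists i, isomorphic S (simp i)
}.

Section Convex.
Variables (R : realType) (m1 m2 : nat).
Notation V := 'M[R]_(m1, m2).

Definition conv_hull (E : set V) : set V :=
  [set u | exists (k : nat) (x : 'I_k -> V) (a : 'I_k -> R),
    [/\ forall i, E (x i), forall i, 0 <= a i, \sum_i a i = 1
      & u = \sum_i a i *: x i]].

Definition lin_span (E : set V) : set V :=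
  [set u | exists s : seq V,
    (forall x, x \in s -> E x) /\ u \in <<s>>%VS].

(* The dimension of a cone is that of its linear span. *)
Definition has_dim (E : set V) (d : nat) :=
  exists U : {vspace V}, lin_span E = [set u | u \in U] /\ \dim U = d.

(* Relative interior of a cone: the linear span of a nonempty cone is also its
   affine hull. *)
Definition relint (E : set V) : set V :=
  [set u | E u /\ \forall y \near u, lin_span E y -> E y].

End Convex.

(* K_0(A)_R has basis [S(1)], ..., [S(n)] and is identified with the space of
   row vectors; its dual is the space of column vectors, in the dual basis. *)
Notation K0 R n := 'rV[R]_n.
Notation K0dual R n := 'cV[R]_n.

Section Semistable.
Variables (R : realType) (n : nat) (A : length_cat n).
Implicit Types (X M L N Q S : A) (theta eta : K0dual R n) (v : K0 R n).
Implicit Types sigma tau : set (K0dual R n).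

Definition pairing theta v : R := (v *m theta) 0 0.

(* The Jordan-Hoelder multiplicity of S(i) in X. *)
Definition mult X (i : 'I_n) : nat :=
  count (fun S => `[< isomorphic S (simp A i) >])
    (sval (cid (all_finite_length X))).

(* The class [X] = \sum_i (mult X i) [S(i)]. *)
Definition K0class X : K0 R n := \row_i (mult X i)%:R.

Definition value theta X : R := pairing theta (K0class X).

Definition K0le v v' := exists a : 'I_n -> R,
  (forall i, 0 <= a i) /\ v' - v = \sum_i a i *: K0class (simp A i).

Definition K0lt v v' := K0le v v' /\ v <> v'.

Definition Tbar theta X :=
  forall N (p : hom X N), is_epi p -> 0 <= value theta N.
Definition Fcat theta X :=
  forall L (i : hom L X), is_mono i -> ~ is_zero L -> value theta L < 0.
Definition Tcat theta X :=
  forall N (p : hom X N), is_epi p -> ~ is_zero N -> 0 < value theta N.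
Definition Fbar theta X :=
  forall L (i : hom L X), is_mono i -> value theta L <= 0.
Definition Wcat theta X := Tbar theta X /\ Fbar theta X.

Definition tbar_sub theta M : subobject M := largest_sub (Tbar theta) M.
Definition t_sub theta M : subobject M := largest_sub (Tcat theta) M.
Definition f_obj theta M : A := coker (sub_arr (tbar_sub theta M)).
Definition w_obj theta M : A :=
  coker (sub_incl (t_sub theta M) (tbar_sub theta M)).

(* The composition factors of X in the category W_theta, as an
   isomorphism-closed class of objects. *)
Definition supp theta X : set A :=
  [set S | exists (hX : Wcat theta X) (hS : Wcat theta S),
    @comp_factor (full_subcat (Wcat theta)) (exist _ X hX) (exist _ S hS)].

(* As w_theta M and f_theta M are the subquotient tbar/t and the quotient
   M/tbar of M, they are determined as such by t and tbar and conversely. *)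
Definition TF_equiv M theta eta :=
  [/\ sub_eq (t_sub theta M) (t_sub eta M),
      sub_eq (tbar_sub theta M) (tbar_sub eta M)
    & supp theta (w_obj theta M) = supp eta (w_obj eta M)].

Definition Sigma M : set (set (K0dual R n)) :=
  [set sigma | exists theta, sigma = closure [set eta | TF_equiv M theta eta]].

Definition Sigma_max M : set (set (K0dual R n)) :=
  [set sigma | Sigma M sigma /\ has_dim sigma n].

Definition newton M : set (K0 R n) :=
  conv_hull [set u | exists U : subobject M, u = K0class (sub_dom U)].

Definition max_face (P : set (K0 R n)) theta : set (K0 R n) :=
  [set u | P u /\ forall u', P u' -> pairing theta u' <= pairing theta u].

Definition is_vertex (P : set (K0 R n)) v :=
  exists theta, max_face P theta = [set v].

Definition vertex_of M sigma v :=
  is_vertex (newton M) v /\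
  forall theta, relint sigma theta -> max_face (newton M) theta = [set v].

(* A point of the relative interior of sigma. *)
Definition int_point sigma : K0dual R n := xget 0 (relint sigma).

Definition t_cone sigma M : A := sub_dom (t_sub (int_point sigma) M).
Definition f_cone sigma M : A := f_obj (int_point sigma) M.

Definition bd_plus M sigma : set (K0dual R n) :=
  [set theta | sigma theta /\ ~ Tcat theta (t_cone sigma M)].
Definition bd_minus M sigma : set (K0dual R n) :=
  [set theta | sigma theta /\ ~ Fcat theta (f_cone sigma M)].

Definition is_face sigma tau := exists v,
  (forall theta, sigma theta -> 0 <= pairing theta v) /\
  tau = sigma `&` [set theta | pairing theta v = 0].

Definition Facet sigma : set (set (K0dual R n)) :=
  [set tau | is_face sigma tau /\
    exists d, has_dim sigma d.+1 /\ has_dim tau d].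

Definition Facet_plus M sigma : set (set (K0dual R n)) :=
  [set tau | Facet sigma tau /\ tau `<=` bd_plus M sigma].
Definition Facet_minus M sigma : set (set (K0dual R n)) :=
  [set tau | Facet sigma tau /\ tau `<=` bd_minus M sigma].

End Semistable.

(* Main.v *)
Require Import Defs.
From HB Require Import structures.
From mathcomp Require Import all_boot all_order all_algebra.
From mathcomp Require Import boolp classical_sets reals topology normedtype.

Set Implicit Arguments.
Unset Strict Implicit.
Unset Printing Implicit Defensive.

Import Order.TTheory GRing.Theory Num.Theory.
Import numFieldNormedType.Exports.
Local Open Scope classical_set_scope.
Local Open Scope ring_scope.
(* The names hom and comp of the categorical definitions take precedence. *)
Import Defs.

(** Everything is read off from the finite set P of classes [U] of subobjects U
    of M, ordered componentwise. Let theta be a functional and call U a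
    maximizer if theta(U) is maximal. Then U lies in Tbar_theta and M/U lies in
    Fbar_theta, because quotients of U and subobjects of M/U have classes
    [U] - [L] and [W] - [U] for subobjects L and W of M. Consequently
    t_theta M and tbar_theta M are the smallest and the largest maximizer
    ([t_subP], [tbar_subP]), and if V is a maximizer not contained in U, then
    the image I of V in M/U is a nonzero common subquotient with theta(I) = 0
    ([maximizer_image]). Additivity of [X] on short exact sequences, which is
    behind all this, is the Jordan-Hoelder theorem ([jordan_holder]).

    If a TF equivalence class spans the dual space, then theta(w_theta M) = 0
    on the class forces w_theta M = 0, so t_theta M = tbar_theta M is the only
    maximizer and the class is the open normal cone of P at v = [t_theta M]
    ([TF_class_normal_cone]). Hence sigma is the cone of all theta with
    theta(u) <= theta(v) for all u in P. The images I above show that theta in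
    sigma belongs to bd_plus (bd_minus) exactly when theta(u) = theta(v) for
    some u < v (u > v) in P, and that each boundary point belongs to bd_plus or
    bd_minus ([not_TcatP], [not_FcatP], [boundary_walls]).

    The rest is convex geometry. A facet with inner normal w is a convex set
    covered by finitely many hyperplanes theta(v - u) = 0, hence is contained
    in one of them, which means that v - u is a positive multiple of w. So a
    facet lies in bd_plus if w > 0, in bd_minus if w < 0, always in one of the
    two and never in both ([facet_dichotomy]). For the union formula, suppose
    that theta(u) = theta(v) with u < v and write v - u as a nonnegative
    combination of an irredundant set of generators of the dual cone. Those
    which occur vanish at theta and are normals of facets, by Farkas' lemma
    ([irredundant_facet]); they cannot all be negative as v - u is positive
    ([wall_facets]). Finally, the vertices v and v' of two adjacent cones
    differ by a positive multiple of the normal of the common facet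
    ([adjacent_vertex]). *)

Local Notation "g \c f" := (comp g f) (at level 40, left associativity).

(** * Abelian categories *)

Section PreadditiveFacts.
Variable C : preadditive.
Implicit Types X Y Z K Q S : C.

Lemma comp0m X Y Z (f : hom X Y) : (0 : hom Y Z) \c f = 0.
Proof. by apply: (addrI (0 \c f)); rewrite -compDl !addr0. Qed.

Lemma compm0 X Y Z (g : hom Y Z) : g \c (0 : hom X Y) = 0.
Proof. by apply: (addrI (g \c 0)); rewrite -compDr !addr0. Qed.

Lemma compBl X Y Z (g g' : hom Y Z) (f : hom X Y) :
  (g - g') \c f = g \c f - g' \c f.
Proof.
apply: (addIr (g' \c f)); rewrite -compDl subrK.
by rewrite subrK.
Qed.

Lemma compBr X Y Z (g : hom Y Z) (f f' : hom X Y) :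
  g \c (f - f') = g \c f - g \c f'.
Proof.
apply: (addIr (g \c f')); rewrite -compDr subrK.
by rewrite subrK.
Qed.

Lemma mono0P X Y (f : hom X Y) :
  is_mono f <-> forall Z (g : hom Z X), f \c g = 0 -> g = 0.
Proof.
split=> [mf Z g fg0|f0 Z g h fgh]; first by apply: mf; rewrite fg0 compm0.
by apply/subr0_eq/f0; rewrite compBr fgh subrr.
Qed.

Lemma epi0P X Y (f : hom X Y) :
  is_epi f <-> forall Z (g : hom Y Z), g \c f = 0 -> g = 0.
Proof.
split=> [ef Z g fg0|f0 Z g h fgh]; first by apply: ef; rewrite fg0 comp0m.
by apply/subr0_eq/f0; rewrite compBl fgh subrr.
Qed.

Lemma from_zero X Y (f : hom X Y) : is_zero X -> f = 0.
Proof. by move=> X0; have [X0Y _] := X0 Y; apply: X0Y. Qed.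

Lemma to_zero X Y (f : hom X Y) : is_zero Y -> f = 0.
Proof. by move=> Y0; have [_ Y0X] := Y0 X; apply: Y0X. Qed.

Lemma is_zeroP X : is_zero X <-> idm X = 0.
Proof.
split=> [X0|X0 Y]; first by have [] := X0 X.
by split=> f; [rewrite -[f]compm1 X0 compm0|rewrite -[f]comp1m X0 comp0m].
Qed.

Lemma zero_mono X Y (f : hom X Y) : is_mono f -> is_zero Y -> is_zero X.
Proof.
by move=> /mono0P mf Y0; apply/is_zeroP/mf; apply: to_zero.
Qed.

Lemma zero_epi X Y (f : hom X Y) : is_epi f -> is_zero X -> is_zero Y.
Proof.
by move=> /epi0P ef X0; apply/is_zeroP/ef; apply: from_zero.
Qed.

Lemma mono_comp X Y Z (g : hom Y Z) (f : hom X Y) :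
  is_mono g -> is_mono f -> is_mono (g \c f).
Proof. by move=> mg mf T a b; rewrite -!compA => /mg/mf. Qed.

Lemma epi_comp X Y Z (g : hom Y Z) (f : hom X Y) :
  is_epi g -> is_epi f -> is_epi (g \c f).
Proof. by move=> eg ef T a b; rewrite !compA => /ef/eg. Qed.

Lemma mono_cancel X Y Z (g : hom Y Z) (f : hom X Y) :
  is_mono (g \c f) -> is_mono f.
Proof. by move=> mgf T a b e; apply: mgf; rewrite -!compA e. Qed.

Lemma kernel_mono X Y K (f : hom X Y) (k : hom K X) : is_kernel f k -> is_mono k.
Proof.
move=> [fk0 ku] Z g h kgh.
have [|u [_ uniq_u]] := ku Z (k \c h); first by rewrite compA fk0 comp0m.
by rewrite -(uniq_u g) // -(uniq_u h).
Qed.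

Lemma cokernel_epi X Y Q (f : hom X Y) (q : hom Y Q) : is_cokernel f q -> is_epi q.
Proof.
move=> [qf0 qu] Z g h gqh.
have [|u [_ uniq_u]] := qu Z (h \c q); first by rewrite -compA qf0 compm0.
by rewrite -(uniq_u g) // -(uniq_u h).
Qed.

Lemma kernel_lift X Y K Z (f : hom X Y) (k : hom K X) (h : hom Z X) :
  is_kernel f k -> f \c h = 0 -> exists u, k \c u = h.
Proof. by move=> [_ ku] /ku [u [? _]]; exists u. Qed.

Lemma cokernel_desc X Y Q Z (f : hom X Y) (q : hom Y Q) (h : hom Y Z) :
  is_cokernel f q -> h \c f = 0 -> exists u, u \c q = h.
Proof. by move=> [_ qu] /qu [u [? _]]; exists u. Qed.

Lemma is_kernelP X Y K (f : hom X Y) (k : hom K X) : is_mono k -> f \c k = 0 ->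
  (forall Z (h : hom Z X), f \c h = 0 -> exists u, k \c u = h) -> is_kernel f k.
Proof.
move=> mk fk0 kl; split=> // Z h /kl [u ku]; exists u; split=> // u' ku'.
by apply: mk; rewrite ku.
Qed.

Lemma is_cokernelP X Y Q (f : hom X Y) (q : hom Y Q) : is_epi q -> q \c f = 0 ->
  (forall Z (h : hom Y Z), h \c f = 0 -> exists u, u \c q = h) ->
  is_cokernel f q.
Proof.
move=> eq qf0 ql; split=> // Z h /ql [u uq]; exists u; split=> // u' uq'.
by apply: eq; rewrite uq.
Qed.

Lemma iso_sym X Y : isomorphic X Y -> isomorphic Y X.
Proof. by move=> [f [g [gf fg]]]; exists g, f. Qed.

Lemma iso_trans X Y Z : isomorphic X Y -> isomorphic Y Z -> isomorphic X Z.
Proof.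
move=> [f [f' [f'f ff']]] [g [g' [g'g gg']]].
exists (g \c f), (f' \c g'); split.
  by rewrite compA -(compA f') g'g compm1.
by rewrite compA -(compA g) ff' compm1.
Qed.

Lemma comp_series_inv Y (s : seq C) : comp_series Y s ->
  if s is T :: t then exists X (f : hom X Y) (g : hom Y T),
    [/\ short_exact f g, simple_object T & comp_series X t]
  else is_zero Y.
Proof. by case=> // X Y' S f g t fg sS ht; exists X, f, g. Qed.

Lemma comp_series_zero X (s : seq C) : comp_series X s -> is_zero X -> s = [::].
Proof.
case: s => // S t /comp_series_inv [Y [f [g [[_ cg] [nS _] _]]]] X0.
by case: nS; apply: zero_epi X0; apply: cokernel_epi cg.
Qed.

Lemma comp_factor_zero X S : is_zero X -> ~ comp_factor X S.
Proof. by move=> X0 [s [hs]]; rewrite (comp_series_zero hs X0). Qed.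

End PreadditiveFacts.

Section AbelianFacts.
Variable A : abelian_cat.
Implicit Types X Y Z K Q S M C D B W I : A.

Lemma kernel_of_cokernel X Y Q (k : hom X Y) (q : hom Y Q) :
  is_mono k -> is_cokernel k q -> is_kernel q k.
Proof.
move=> mk cq; have [qk0 _] := cq.
have [Z [g gk]] := mono_normal mk; have [gk0 _] := gk.
apply: is_kernelP => // T h qh0; apply: (kernel_lift gk).
have [u <-] := cokernel_desc cq gk0.
by rewrite -compA qh0 compm0.
Qed.

Lemma cokernel_of_kernel X Y K (k : hom K X) (q : hom X Y) :
  is_epi q -> is_kernel q k -> is_cokernel k q.
Proof.
move=> eq kk; have [qk0 _] := kk.
have [Z [g gq]] := epi_normal eq; have [gq0 _] := gq.
apply: is_cokernelP => // T h hk0; apply: (cokernel_desc gq).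
have [u <-] := kernel_lift kk gq0.
by rewrite compA hk0 comp0m.
Qed.

Lemma mono_epi_iso X Y (f : hom X Y) : is_mono f -> is_epi f -> is_iso f.
Proof.
move=> mf ef; have [Z [g gf]] := mono_normal mf; have [gf0 _] := gf.
have g0 : g = 0 by move/epi0P: ef; apply.
have [|u fu] := kernel_lift gf (h := idm Y); first by rewrite g0 comp0m.
by exists u; split=> //; apply: mf; rewrite compA fu comp1m compm1.
Qed.

Lemma coker_short_exact X Y Q (k : hom X Y) (q : hom Y Q) :
  is_mono k -> is_cokernel k q -> short_exact k q.
Proof. by move=> mk cq; split=> //; apply: kernel_of_cokernel. Qed.

Lemma ker_short_exact X Y K (k : hom K X) (q : hom X Y) :
  is_epi q -> is_kernel q k -> short_exact k q.
Proof. by move=> mk cq; split=> //; apply: cokernel_of_kernel. Qed.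

(** The kernel of the cokernel of f is its image: a subobject through which
    f factors is a kernel, hence contains the kernel of the cokernel. *)
Lemma image_epi X Y I Q (f : hom X Y) (q : hom Y Q) (m : hom I Y)
    (e : hom X I) :
  is_cokernel f q -> is_kernel q m -> m \c e = f -> is_epi e.
Proof.
move=> cq km mef; apply/epi0P => T u ue0.
have [K [k kk]] := has_kernel u; have [uk0 _] := kk.
have [r kr] := kernel_lift kk ue0.
have mm := kernel_mono km.
have [Z [c ck]] := mono_normal (mono_comp mm (kernel_mono kk)).
have [cmk0 _] := ck.
have [|c' c'q] := cokernel_desc cq (h := c).
  by rewrite -mef -kr (compA m) compA cmk0 comp0m.
have cm0 : c \c m = 0 by rewrite -c'q -compA; have [-> _] := km; rewrite compm0.
have [x mkx] := kernel_lift ck cm0.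
have kx1 : k \c x = idm I by apply: mm; rewrite compA mkx compm1.
by rewrite -[u]compm1 -kx1 compA uk0 comp0m.
Qed.

Lemma image_factorization X Y (f : hom X Y) :
  exists I (e : hom X I) (m : hom I Y), [/\ is_epi e, is_mono m & m \c e = f].
Proof.
have [Q [q cq]] := has_cokernel f; have [I [m km]] := has_kernel q.
have [qf0 _] := cq; have [e me] := kernel_lift km qf0.
by exists I, e, m; split; [exact: image_epi cq km me|exact: kernel_mono km|].
Qed.

(** The third isomorphism theorem: for B = Ker c and W = Ker (h c), the
    quotient W/B is the kernel of h.  The map r is epi because h is the
    cokernel of c w, so that m r is the image factorization of c w. *)
Lemma third_iso M C D B W I (c : hom M C) (h : hom C D) (b : hom B M)
    (w : hom W M) (m : hom I C) (j : hom B W) (r : hom W I) :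
  is_epi c -> is_epi h -> is_kernel c b -> is_kernel (h \c c) w ->
  is_kernel h m -> w \c j = b -> m \c r = c \c w -> short_exact j r.
Proof.
move=> ec eh kb kw km wj mr; have [cb0 _] := kb; have [hm0 _] := km.
have mw := kernel_mono kw; have mm := kernel_mono km.
apply: ker_short_exact.
  apply: image_epi _ km mr.
  apply: is_cokernelP => // [|T u]; first by have [+ _] := kw; rewrite compA.
  rewrite compA => ucw0.
  have [u' u'hc] := cokernel_desc (cokernel_of_kernel (epi_comp eh ec) kw) ucw0.
  by exists u'; apply: ec; rewrite -compA.
apply: is_kernelP.
- by apply: (mono_cancel (g := w)); rewrite wj; apply: kernel_mono kb.
- by apply: mm; rewrite compA mr -compA wj cb0 compm0.
move=> Z z rz0; have [|y by_] := kernel_lift kb (h := w \c z).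
  by rewrite compA -mr -compA rz0 compm0.
by exists y; apply: mw; rewrite compA wj.
Qed.

Lemma short_exact_zero_l X Y Z (f : hom X Y) (g : hom Y Z) :
  short_exact f g -> is_zero X -> is_iso g.
Proof.
move=> [kf cg] X0; apply: mono_epi_iso; last exact: cokernel_epi cg.
apply/mono0P => T z gz0; have [u <-] := kernel_lift kf gz0.
by rewrite (to_zero u X0) compm0.
Qed.

Lemma short_exact_zero_r X Y Z (f : hom X Y) (g : hom Y Z) :
  short_exact f g -> is_zero Z -> is_iso f.
Proof.
move=> [kf cg] Z0; apply: mono_epi_iso; first exact: kernel_mono kf.
apply/epi0P => T z zf0; have [u <-] := cokernel_desc cg zf0.
by rewrite (from_zero u Z0) comp0m.
Qed.

(** The composition series is intersected with X' and projected to X'' = X/X'.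
    If the map from X to the top factor S is nonzero on X', then S becomes a
    factor of X', otherwise of X''; the rest of the series belongs to the
    kernel Y of X -> S, which is an extension of the remaining parts. *)
Lemma comp_series_split X s : comp_series X s ->
  forall X' X'' (i : hom X' X) (p : hom X X''), short_exact i p ->
  exists s' s'', [/\ comp_series X' s', comp_series X'' s''
    & forall a, count a s = (count a s' + count a s'')%N].
Proof.
elim=> [{}X X0 X' X'' i p [ki cp]|Y {}X S f g t [kf cg] sS _ IH X' X'' i p [ki cp]].
  exists [::], [::]; split=> //; apply: CompSeries0.
    exact: zero_mono (kernel_mono ki) X0.
  exact: zero_epi (cokernel_epi cp) X0.
have [mi ep] := (kernel_mono ki, cokernel_epi cp).
have [mf eg] := (kernel_mono kf, cokernel_epi cg).
have [[pi0 _] [gf0 _]] := (ki, kf).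
have [gi0|gi0] := pselect (g \c i = 0).
  (* X' is contained in Y, and S is the top factor of X/X'. *)
  have [j fj] := kernel_lift kf gi0.
  have [h hp] := cokernel_desc cp gi0.
  have eh : is_epi h by move=> T a b ab; apply: eg; rewrite -hp !compA ab.
  have [I [m km]] := has_kernel h.
  have [|r mr] := kernel_lift km (h := p \c f).
    by rewrite compA hp.
  have jr : short_exact j r.
    by apply: (third_iso (c := p) (h := h) (b := i) (w := f) (m := m));
      rewrite ?hp.
  have [s' [s'' [hs' hs'' st]]] := IH _ _ _ _ jr.
  exists s', (S :: s''); split=> //.
    by apply: CompSeriesS hs'' => //; apply: ker_short_exact km.
  by move=> a /=; rewrite st addnCA.
(* S is the top factor of X', with kernel the intersection K of X' and Y. *)
have egi : is_epi (g \c i).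
  have [I [e [m [ee mm me]]]] := image_factorization (g \c i).
  have [I0|[m' [_ mm']]] := sS.2 _ _ mm.
    by case: gi0; rewrite -me (from_zero m I0) comp0m.
  by rewrite -me; apply: epi_comp => // T a b ab;
    rewrite -[a]compm1 -[b]compm1 -mm' !compA ab.
have [K [k kk]] := has_kernel (g \c i); have [gik0 _] := kk.
have [|j fj] := kernel_lift kf (h := i \c k); first by rewrite compA.
have jpf : short_exact j (p \c f).
  apply: ker_short_exact.
    apply/epi0P => T u; rewrite compA => upf0.
    have [w wg] := cokernel_desc cg upf0.
    have w0 : w = 0.
      move/epi0P: egi; apply; rewrite compA wg -compA pi0.
      by rewrite compm0.
    by move/epi0P: ep; apply; rewrite -wg w0 comp0m.
  apply: is_kernelP.
  - apply: (mono_cancel (g := f)); rewrite fj.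
    exact: mono_comp mi (kernel_mono kk).
  - by rewrite -compA fj compA pi0 comp0m.
  move=> Z z; rewrite -compA => pfz0.
  have [y iy] := kernel_lift ki pfz0.
  have [|x kx] := kernel_lift kk (h := y).
    by rewrite -compA iy compA gf0 comp0m.
  by exists x; apply: mf; rewrite compA fj -compA kx.
have [s' [s'' [hs' hs'' st]]] := IH _ _ _ _ jpf.
exists (S :: s'), s''; split=> //.
  by apply: (CompSeriesS _ sS hs'); apply: ker_short_exact kk.
by move=> a /=; rewrite st addnA.
Qed.

Lemma simple_comp_series S : simple_object S -> comp_series S [:: S].
Proof.
move=> sS; have [O O0] := has_zero A.
apply: (@CompSeriesS _ O S S 0 (idm S)) => //; last exact: CompSeries0.
apply: ker_short_exact; first by move=> T a b; rewrite !compm1.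
apply: is_kernelP; [|exact: compm0|].
  by move=> T a b _; rewrite (to_zero a O0) (to_zero b O0).
by move=> T h; rewrite comp1m => ->; exists 0; rewrite comp0m.
Qed.

Lemma comp_series_simple S s : simple_object S -> comp_series S s ->
  exists2 S', s = [:: S'] & isomorphic S S'.
Proof.
move=> [nS sS]; case: s => [/comp_series_inv //|S' t].
move=> /comp_series_inv [X [f [g [fg [nS' _] ht]]]].
have [X0|[f' [_ ff']]] := sS _ _ (kernel_mono fg.1).
  exists S'; first by rewrite (comp_series_zero ht X0).
  by exists g; apply: short_exact_zero_l fg X0.
case: nS'; apply/is_zeroP; have [[gf0 _] cg] := fg.
move/epi0P: (cokernel_epi cg); apply.
by rewrite comp1m -[g]compm1 -ff' compA gf0 comp0m.
Qed.

(** Splitting one series along the top factor of the other one leaves two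
    series of the same maximal subobject. *)
Lemma jordan_holder X s1 s2 T : comp_series X s1 -> comp_series X s2 ->
  let a S := `[< isomorphic S T >] in count a s1 = count a s2.
Proof.
move=> + h2 /=; elim: h2 s1 => [{}X X0 s1 /comp_series_zero -> //|].
move=> Y {}X S f g t fg sS _ IH s1 h1.
have [s' [s'' [hs' hs'' ->]]] := comp_series_split h1 fg.
have [S' -> SS'] := comp_series_simple sS hs''.
rewrite /= (IH _ hs') addn0 addnC; congr (nat_of_bool _ + _)%N.
apply: asbool_equiv_eq; split; first exact: iso_trans.
by apply: iso_trans; apply: iso_sym.
Qed.

End AbelianFacts.

(** * The class of an object in the Grothendieck group *)

Section GrothendieckClass.
Variables (R : realType) (n : nat) (A : length_cat n).
Implicit Types X Y Z M L N S : A.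
Local Notation K0class := (@K0class R n A).

Lemma multE X i s : comp_series X s ->
  mult X i = count (fun S => `[< isomorphic S (simp A i) >]) s.
Proof.
rewrite /mult; case: (cid _) => s0 /= h0 h.
exact: jordan_holder h0 h.
Qed.

Lemma mult_short_exact X Y Z (f : hom X Y) (g : hom Y Z) i :
  short_exact f g -> mult Y i = (mult X i + mult Z i)%N.
Proof.
move=> fg; have [s hs] := all_finite_length Y.
have [s' [s'' [hs' hs'' st]]] := comp_series_split hs fg.
by rewrite (multE i hs) (multE i hs') (multE i hs'') st.
Qed.

Lemma K0class_short_exact X Y Z (f : hom X Y) (g : hom Y Z) :
  short_exact f g -> K0class Y = K0class X + K0class Z.
Proof.
by move=> fg; apply/rowP => i; rewrite !mxE (mult_short_exact i fg) natrD.
Qed.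

Lemma K0class_simp i : K0class (simp A i) = delta_mx 0 i.
Proof.
apply/rowP => j; rewrite !mxE eqxx /=.
rewrite (multE j (simple_comp_series (simp_simple A i))) /= addn0.
congr ((nat_of_bool _)%:R); apply/asboolP/eqP => [/simp_inj //|->].
by exists (idm _), (idm _); rewrite comp1m.
Qed.

Lemma K0class_ge0 X j : 0 <= K0class X 0 j.
Proof. by rewrite mxE. Qed.

(** Every simple object is counted by one of the multiplicities, so that a
    composition series of an object of class 0 is empty. *)
Lemma K0class_eq0 X : K0class X = 0 -> is_zero X.
Proof.
move=> X0; have [[|S s] hs] := all_finite_length X.
  exact: comp_series_inv hs.
have [Y [f [g [_ sS _]]]] := comp_series_inv hs.
have [i Si] := simp_all sS.
move/rowP/(_ i): X0; rewrite !mxE (multE i hs) /=.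
by move/asboolP: Si => ->; move/eqP; rewrite pnatr_eq0.
Qed.

Lemma K0leP (v v' : K0 R n) : K0le A v v' <-> forall j, v 0 j <= v' 0 j.
Proof.
have sum_simp a : \sum_i a i *: K0class (simp A i) = \row_i a i.
  rewrite [RHS]row_sum_delta; apply: eq_bigr => i _.
  by rewrite K0class_simp mxE.
split=> [[a [a0]]|le_v].
  by rewrite sum_simp => /rowP va j; rewrite -subr_ge0; move: (va j); rewrite !mxE => ->.
exists (fun i => (v' - v) 0 i); split=> [i|].
  by rewrite !mxE subr_ge0.
by rewrite sum_simp; apply/rowP => i; rewrite !mxE.
Qed.

(** ** Subobjects *)

Lemma sub_le_class M (U V : subobject M) : sub_le U V ->
  forall j, K0class (sub_dom U) 0 j <= K0class (sub_dom V) 0 j.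
Proof.
move=> [h Vh] j; have [Q [q cq]] := has_cokernel h.
have mh : is_mono h.
  by apply: (mono_cancel (g := sub_arr V)); rewrite Vh; apply: sub_mono.
rewrite (K0class_short_exact (coker_short_exact mh cq)) [leRHS]mxE lerDl.
exact: K0class_ge0.
Qed.

Lemma sub_le_incl M (U V : subobject M) :
  sub_le U V -> sub_arr V \c sub_incl U V = sub_arr U.
Proof. by move=> [h hV]; rewrite /sub_incl; case: xgetP => // /(_ h). Qed.

Lemma sub_le_class_eq M (U V : subobject M) : sub_le U V ->
  K0class (sub_dom U) = K0class (sub_dom V) -> is_iso (sub_incl U V).
Proof.
move=> UV eUV; have VU := sub_le_incl UV.
have mh : is_mono (sub_incl U V).
  by apply: (mono_cancel (g := sub_arr V)); rewrite VU; apply: sub_mono.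
have [Q [q cq]] := has_cokernel (sub_incl U V).
have se := coker_short_exact mh cq.
apply: (short_exact_zero_r se); apply: K0class_eq0.
by move: (K0class_short_exact se); rewrite eUV -[LHS]addr0 => /addrI.
Qed.

Lemma sub_le_eq M (U V : subobject M) : sub_le U V ->
  K0class (sub_dom U) = K0class (sub_dom V) -> sub_eq U V.
Proof.
move=> UV eUV; split=> //; have [g [_ hg]] := sub_le_class_eq UV eUV.
by exists g; rewrite -(sub_le_incl UV) -compA hg compm1.
Qed.

Lemma sub_eq_class M (U V : subobject M) :
  sub_eq U V -> K0class (sub_dom U) = K0class (sub_dom V).
Proof.
move=> [UV VU]; apply/rowP => j.
by apply/eqP; rewrite eq_le !sub_le_class.
Qed.

Lemma sub_le_trans M (U V W : subobject M) :
  sub_le U V -> sub_le V W -> sub_le U W.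
Proof. by move=> [f Vf] [g Wg]; exists (g \c f); rewrite compA Wg. Qed.

Lemma sub_eq_trans M (U V W : subobject M) :
  sub_eq U V -> sub_eq V W -> sub_eq U W.
Proof.
by move=> [UV VU] [VW WV]; split; [apply: sub_le_trans UV VW|apply: sub_le_trans WV VU].
Qed.

Lemma sub_eq_sym M (U V : subobject M) : sub_eq U V -> sub_eq V U.
Proof. by move=> []. Qed.

Lemma coker_iso_zero X Y (f : hom X Y) : is_iso f -> is_zero (coker f).
Proof.
move=> [g [_ fg]]; rewrite /coker; case: (cid _) => Q [q cq] /=.
have [qf0 _] := cq; have q0 : q = 0.
  by rewrite -[q]compm1 -fg compA qf0 comp0m.
by apply/is_zeroP; move/epi0P: (cokernel_epi cq); apply; rewrite q0 compm0.
Qed.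


Lemma coker_cokernel X Y (f : hom X Y) :
  exists q : hom Y (coker f), is_cokernel f q.
Proof. by rewrite /coker; case: (cid _) => Q [q cq] /=; exists q. Qed.

(** The quotients of a subobject U of M and the subobjects of M/U both
    correspond to subobjects of M, which turns conditions on their values into
    comparisons of values of subobjects of M. *)
Lemma sub_of_quotient M (U : subobject M) N (p : hom (sub_dom U) N) :
  is_epi p -> exists2 L : subobject M, sub_le L U &
    K0class (sub_dom U) = K0class (sub_dom L) + K0class N.
Proof.
move=> ep; have [K [k kk]] := has_kernel p.
exists (Subobject (mono_comp (@sub_mono _ _ U) (kernel_mono kk))).
  by exists k.
exact: K0class_short_exact (ker_short_exact ep kk).
Qed.

Lemma sub_of_sub_coker M (U : subobject M) C (c : hom M C) L (l : hom L C) :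
  is_cokernel (sub_arr U) c -> is_mono l -> exists2 W : subobject M, sub_le U W &
    K0class (sub_dom W) = K0class (sub_dom U) + K0class L.
Proof.
move=> cc ml; have ku := kernel_of_cokernel (@sub_mono _ _ U) cc.
have ec := cokernel_epi cc; have [cu0 _] := cc.
have [D [h ch]] := has_cokernel l; have kl := kernel_of_cokernel ml ch.
have [W [w kw]] := has_kernel (h \c c); have [hcw0 _] := kw.
have [|j wj] := kernel_lift kw (h := sub_arr U).
  by rewrite -compA cu0 compm0.
have [|r lr] := kernel_lift kl (h := c \c w); first by rewrite compA.
exists (Subobject (kernel_mono kw)); first by exists j.
exact: K0class_short_exact
  (third_iso ec (cokernel_epi ch) ku kw kl wj lr).
Qed.

(** The image I of V in M/U is the common subquotient V/(U :&: V) = (U + V)/U;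
    comparing with I replaces intersections and sums of subobjects. *)
Lemma sub_image M (U V : subobject M) C (c : hom M C) :
  is_cokernel (sub_arr U) c ->
  exists I (e : hom (sub_dom V) I) (m : hom I C),
  [/\ is_epi e, is_mono m & is_zero I -> sub_le V U].
Proof.
move=> cc; have [I [e [m [ee mm me]]]] := image_factorization (c \c sub_arr V).
exists I, e, m; split=> // I0.
apply: (kernel_lift (kernel_of_cokernel (@sub_mono _ _ U) cc)).
by rewrite -me (from_zero m I0) comp0m.
Qed.

(** Multiplicities in a subobject are bounded by those in M. *)
Lemma sub_classes_finite M : exists P : seq (K0 R n), forall u,
  (u \in P) <-> exists U : subobject M, u = K0class (sub_dom U).
Proof.
pose B := \max_i mult M i.
pose all_u := [seq (\row_i (nat_of_ord (f i))%:R : K0 R n)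
  | f : {ffun 'I_n -> 'I_B.+1} <- enum {: {ffun 'I_n -> 'I_B.+1}}].
pose sub_u (u : K0 R n) := `[< exists U : subobject M, u = K0class (sub_dom U) >].
exists [seq u <- all_u | sub_u u] => u; rewrite mem_filter.
split=> [/andP[/asboolP //]|hu]; apply/andP; split; first exact/asboolP.
have [U ->] := hu.
have leB i : (mult (sub_dom U) i < B.+1)%N.
  rewrite ltnS (leq_trans _ (leq_bigmax i)) //.
  have [Q [q cq]] := has_cokernel (sub_arr U).
  rewrite (mult_short_exact i (coker_short_exact (@sub_mono _ _ U) cq)).
  exact: leq_addr.
apply/mapP; exists [ffun i => Ordinal (leB i)]; first by rewrite mem_enum.
by apply/rowP => i; rewrite !mxE ffunE.
Qed.

End GrothendieckClass.

(** * Polyhedral cones *)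

Section ConvexCones.
Variables (R : realType) (n : nat).
Local Notation V := 'rV[R]_n.
Local Notation dual := 'cV[R]_n.
Implicit Types (x u v w g : V) (theta eta d : dual) (s : seq V).

Lemma pairingDr theta x y : pairing theta (x + y) = pairing theta x + pairing theta y.
Proof. by rewrite /pairing mulmxDl mxE. Qed.

Lemma pairingZr theta a x : pairing theta (a *: x) = a * pairing theta x.
Proof. by rewrite /pairing -scalemxAl mxE. Qed.

Lemma pairingBr theta x y : pairing theta (x - y) = pairing theta x - pairing theta y.
Proof. by rewrite pairingDr -scaleN1r pairingZr mulN1r. Qed.

Lemma pairing0r theta : pairing theta 0 = 0 :> R.
Proof. by rewrite /pairing mul0mx mxE. Qed.

Lemma pairingDl theta eta x : pairing (theta + eta) x = pairing theta x + pairing eta x.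
Proof. by rewrite /pairing mulmxDr mxE. Qed.

Lemma pairingZl a theta x : pairing (a *: theta) x = a * pairing theta x.
Proof. by rewrite /pairing -scalemxAr mxE. Qed.

Lemma pairingNl theta x : pairing (- theta) x = - pairing theta x.
Proof. by rewrite -scaleN1r pairingZl mulN1r. Qed.

Lemma pairing0l x : pairing 0 x = 0 :> R.
Proof. by rewrite /pairing mulmx0 mxE. Qed.

Lemma pairing_delta i x : pairing (delta_mx i 0) x = x 0 i.
Proof. by rewrite /pairing -colE mxE. Qed.

Lemma pairing_inj x y : (forall theta, pairing theta x = pairing theta y) -> x = y.
Proof. by move=> xy; apply/rowP => i; rewrite -!pairing_delta xy. Qed.

Definition convex_cone (Q : set V) :=
  [/\ Q 0, forall x y, Q x -> Q y -> Q (x + y)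
    & forall a x, 0 <= a -> Q x -> Q (a *: x)].

(** An intersection of convex cones, rather than a set of linear combinations:
    no bookkeeping of coefficients is needed to compare the hulls of
    different families of generators. *)
Definition cone_hull s : set V :=
  [set x | forall Q, convex_cone Q -> (forall g, g \in s -> Q g) -> Q x].

Lemma cone_hull_mem s g : g \in s -> cone_hull s g.
Proof. by move=> gs Q _; apply. Qed.

Lemma cone_hull_trans s s' x :
  (forall g, g \in s -> cone_hull s' g) -> cone_hull s x -> cone_hull s' x.
Proof. by move=> ss' sx Q cQ s'Q; apply: sx => // g /ss'; apply. Qed.

Lemma cone_hull_sub s s' x :
  {subset s <= s'} -> cone_hull s x -> cone_hull s' x.
Proof. by move=> ss'; apply: cone_hull_trans => g /ss'/cone_hull_mem. Qed.

Lemma convex_cone_ge0 theta : convex_cone [set x | 0 <= pairing theta x].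
Proof.
split=> [|x y /= x0 y0|a x /= a0 x0]; first by rewrite /= pairing0r.
  by rewrite pairingDr addr_ge0.
by rewrite pairingZr mulr_ge0.
Qed.

Lemma cone_hull_ge0 s theta x : (forall g, g \in s -> 0 <= pairing theta g) ->
  cone_hull s x -> 0 <= pairing theta x.
Proof. by move=> s0 sx; apply: (sx _ (convex_cone_ge0 theta)). Qed.

(** Farkas' lemma, by induction on the generators: if a functional theta
    separating b from all generators but g is negative on g, the projection
    pr along g onto the kernel of theta reduces the question to one generator
    less. *)
Lemma farkas s b :
  (exists theta, pairing theta b < 0 /\ forall g, g \in s -> 0 <= pairing theta g)
  \/ cone_hull s b.
Proof.
have [m] := ubnP (size s); elim: m s b => // m IH [|g s] b /= sz.
  have [->|/rowP bn0] := pselect (b = 0); [by right=> Q []|left].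
  have [i bi] : exists i, b 0 i != 0.
    by apply: contrapT => nb; apply: bn0 => i; rewrite mxE;
      apply/eqP/negPn/negP => bi; apply: nb; exists i.
  exists (- b 0 i *: delta_mx i 0); split=> //.
  by rewrite pairingZl pairing_delta mulNr oppr_lt0 -expr2 exprn_even_gt0.
have [[theta [theta_b theta_s]]|sb] := IH s b sz; last first.
  by right; apply: cone_hull_sub sb => h hs; rewrite inE hs orbT.
have [theta_g|theta_g] := leP 0 (pairing theta g).
  by left; exists theta; split=> // h /predU1P[->|/theta_s].
pose a := - (pairing theta g)^-1.
have a0 : 0 < a by rewrite /a oppr_gt0 invr_lt0.
have ag : a * pairing theta g = -1 by rewrite /a mulNr mulVf // lt_eqF.
pose pr h := h + (a * pairing theta h) *: g.
have [|[eta [eta_b eta_s]]|prb] := IH [seq pr h | h <- s] (pr b).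
- by rewrite size_map.
- left; exists (eta + (a * pairing eta g) *: theta).
  have pr_eta h : pairing (eta + (a * pairing eta g) *: theta) h
      = pairing eta (pr h).
    by rewrite pairingDl pairingZl /pr pairingDr pairingZr mulrAC.
  split; first by rewrite pr_eta.
  move=> h /predU1P[->|hs]; last by rewrite pr_eta eta_s ?map_f.
  by rewrite pr_eta /pr ag scaleN1r subrr pairing0r.
right=> Q cQ gsQ; have [_ QD QZ] := cQ.
have Qg : Q g by apply: gsQ; rewrite mem_head.
have -> : b = pr b + (- (a * pairing theta b)) *: g.
  by rewrite /pr scaleNr addrK.
apply: (QD); last by apply: (QZ) => //; rewrite oppr_ge0 pmulr_rle0 // ltW.
apply: prb => // _ /mapP[h hs ->]; apply: (QD); first by apply: gsQ; rewrite inE hs orbT.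
by apply: (QZ) => //; rewrite mulr_ge0 ?theta_s // ltW.
Qed.

Lemma irredundant_generators s : exists s',
  [/\ {subset s' <= s}, forall g, g \in s -> cone_hull s' g
    & forall g, g \in s' -> ~ cone_hull (rem g s') g].
Proof.
have [m] := ubnP (size s); elim: m s => // m IH s sz.
have [[g [gs red_g]]|irr] := pselect (exists g, g \in s /\ cone_hull (rem g s) g).
  have [|s' [s's gen irr]] := IH (rem g s).
    by rewrite size_rem //; case: s gs sz {red_g} => //= h t _; rewrite ltnS => /ltnW.
  exists s'; split=> // [h /s's /mem_rem //|h hs].
  apply: cone_hull_trans gen _.
  have [->//|hg] := eqVneq h g; apply: cone_hull_mem.
  by rewrite (perm_mem (perm_to_rem gs)) inE (negPf hg) in hs.
exists s; split=> //; first exact: cone_hull_mem.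
by move=> g gs red_g; apply: irr; exists g.
Qed.

(** ** Topology of the dual space *)

Lemma pairing_continuous x : continuous (fun theta : dual => pairing theta x).
Proof.
have -> : (fun theta : dual => pairing theta x)
    = fun theta => \sum_i x 0 i * theta i 0.
  by apply/funext => theta; rewrite /pairing mxE.
apply: continuous_big; first exact: add_continuous.
move=> i _ theta; apply: (@continuous_comp _ _ _ (fun t : dual => t i 0) ( *%R (x 0 i))).
  exact: coord_continuous.
exact: mulrl_continuous.
Qed.

Lemma near_pairing_gt0 s theta : (forall x, x \in s -> 0 < pairing theta x) ->
  \forall eta \near theta, forall x, x \in s -> 0 < pairing eta x.
Proof.
elim: s => [|g s IH] gt0; first by apply: (@filterE _ (nbhs theta)) => eta x; rewrite in_nil.
have g0 : \forall eta \near theta, 0 < pairing eta g.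
  have := @cvgr_gt R _ (nbhs theta) _ (fun eta => pairing eta g) _ (@pairing_continuous g theta) 0.
  by apply; apply: gt0; rewrite mem_head.
have s0 : \forall eta \near theta, forall x, x \in s -> 0 < pairing eta x.
  by apply: IH => x xs; apply: gt0; rewrite inE xs orbT.
near=> eta => x; rewrite inE => /predU1P[->|].
  by near: eta.
by move: x; near: eta.
Unshelve. all: by end_near. Qed.

Lemma closure_pairing_ge0 (E : set dual) x :
  (forall eta, E eta -> 0 <= pairing eta x) ->
  forall theta, closure E theta -> 0 <= pairing theta x.
Proof.
move=> E0 theta /(closure_subset E0).
exact: ((continuous_closedP _).1 (@pairing_continuous x) _ (@closed_ge R 0)).
Qed.

Lemma near_ray (B : set dual) theta d :
  nbhs theta B -> exists2 e : R, 0 < e & B (theta + e *: d).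
Proof.
move=> /nbhs_normP [e /= e0 sB].
have d0 : 0 < 1 + `|d| by rewrite ltr_pwDl.
have t0 : 0 < e / (1 + `|d|) by rewrite divr_gt0.
exists (e / (1 + `|d|)) => //; apply: sB => /=.
rewrite opprD addNKr normrN normrZ gtr0_norm //.
by rewrite mulrAC ltr_pdivrMr // ltr_pM2l // ltrDr.
Qed.

(** ** Linear spans of cones *)

Definition hyperplane x : {vspace dual} := lker (linfun (mulmx x)).

Lemma mem_hyperplane x theta : (theta \in hyperplane x) = (pairing theta x == 0).
Proof.
rewrite memv_ker lfunE /=; apply/eqP/eqP => [e|e].
  by rewrite /pairing e mxE.
by apply/matrixP => i j; rewrite !ord1 [RHS]mxE.
Qed.

Lemma dim_fullv_dual : \dim {: dual} = n.
Proof. by rewrite dimvf /dim /= muln1. Qed.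

Lemma dim_hyperplane x : x != 0 -> (\dim (hyperplane x)).+1 = n.
Proof.
move=> x0; have := limg_ker_dim (linfun (mulmx x : dual -> 'M_1)) fullv.
rewrite capfv dim_fullv_dual -/(hyperplane x) => dimE.
suff -> : (\dim (hyperplane x)).+1 = (\dim (hyperplane x) + 1)%N.
  rewrite -[RHS]dimE; congr addn; apply/eqP; rewrite eqn_leq; apply/andP; split.
    rewrite lt0n dimv_eq0; apply: contraNneq x0 => lim0.
    apply/eqP/pairing_inj => theta; rewrite pairing0r.
    have : linfun (mulmx x) theta \in limg (linfun (mulmx x : dual -> 'M_1)).
      by rewrite memv_img ?memvf.
    by rewrite lim0 memv0 lfunE /= /pairing => /eqP ->; rewrite mxE.
  by apply: leq_trans (dimvS (subvf _)) _; rewrite dimvf.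
by rewrite addn1.
Qed.

Lemma lin_span_sub (E : set dual) (U : {vspace dual}) :
  (forall theta, E theta -> theta \in U) ->
  forall theta, lin_span E theta -> theta \in U.
Proof.
move=> EU theta [t [tE theta_t]]; apply: subvP theta_t.
by apply/span_subvP => y /tE /EU.
Qed.

(** A subset of U with an interior point theta relative to U spans U, since
    each vector of U is proportional to the difference of theta and a point
    near it. *)
Lemma lin_span_relopen (E : set dual) (U : {vspace dual}) theta :
  (forall eta, E eta -> eta \in U) -> theta \in U ->
  (\forall eta \near theta, eta \in U -> E eta) ->
  lin_span E = [set eta | eta \in U].
Proof.
move=> EU thetaU nE; apply/seteqP; split=> [eta|eta /= etaU].
  exact: lin_span_sub.
have [e e0 Ee] := near_ray eta nE.
have E0 : E theta by apply: (nbhs_singleton nE).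
exists [:: theta; theta + e *: eta]; split.
  move=> y; rewrite !inE => /orP[/eqP ->//|/eqP ->]; apply: Ee.
  by rewrite memvD // memvZ.
have {1}-> : eta = e^-1 *: (theta + e *: eta - theta).
  by rewrite addrC addKr scalerA mulVf ?scale1r // gt_eqF.
by apply/memvZ/memvB; apply: memv_span; rewrite !inE eqxx ?orbT.
Qed.

(** * The normal cone of a vertex and its facets *)

Definition normal_cone (P : seq V) v : set dual :=
  [set theta | forall u, u \in P -> pairing theta u <= pairing theta v].

Definition open_normal_cone (P : seq V) v : set dual :=
  [set theta | forall u, u \in P -> u != v -> pairing theta u < pairing theta v].

(** The sets bd_plus and bd_minus are the walls for the cones Q of nonnegative
    and of nonpositive vectors. They play symmetric roles, so that Q is left
    arbitrary. *)
Definition wall (Q : set V) (P : seq V) v : set dual :=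
  [set theta | normal_cone P v theta /\ exists u,
    [/\ u \in P, u != v, Q (v - u) & pairing theta u = pairing theta v]].

Lemma open_normal_cone_sub P v theta :
  open_normal_cone P v theta -> normal_cone P v theta.
Proof. by move=> o u uP; have [->//|/(o _ uP)/ltW] := eqVneq u v. Qed.

Lemma near_open_normal_cone P v theta : open_normal_cone P v theta ->
  \forall eta \near theta, open_normal_cone P v eta.
Proof.
move=> o; pose s := [seq v - u | u <- P & u != v].
have := @near_pairing_gt0 s theta; move=> /(_ _)[].
  move=> _ /mapP[u + ->]; rewrite mem_filter => /andP[uv uP].
  by rewrite pairingBr subr_gt0 o.
move=> e /= e0 se; exists e => // eta /se {}se u uP uv.
by rewrite -subr_gt0 -pairingBr se //; apply: map_f; rewrite mem_filter uv.
Qed.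

Lemma normal_coneD P v theta eta : normal_cone P v theta ->
  normal_cone P v eta -> normal_cone P v (theta + eta).
Proof. by move=> nt ne u uP; rewrite !pairingDl lerD ?nt ?ne. Qed.

Lemma normal_cone0 P v : normal_cone P v 0.
Proof. by move=> u _; rewrite !pairing0l. Qed.

Section NormalCone.
Variables (P : seq V) (v : V) (theta0 : dual).
Hypothesis theta0_open : open_normal_cone P v theta0.
Local Notation sigma := (normal_cone P v).
Local Notation open_sigma := (open_normal_cone P v).

Lemma closure_open_normal_cone : closure open_sigma = sigma.
Proof.
apply/seteqP; split=> theta.
  move=> cl u uP.
  rewrite -subr_ge0 -pairingBr; move: theta cl; apply: closure_pairing_ge0.
  move=> eta /open_normal_cone_sub/(_ u uP).
  by rewrite pairingBr subr_ge0.
move=> st B /(near_ray theta0)[e e0 Be]; exists (theta + e *: theta0); split=> //.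
move=> u uP uv; rewrite !pairingDl !pairingZl ler_ltD ?st //.
by rewrite ltr_pM2l // theta0_open.
Qed.

Lemma lin_span_normal_cone : lin_span sigma = setT.
Proof.
rewrite (@lin_span_relopen _ fullv theta0) //.
- by apply/seteqP; split=> // eta _; apply: memvf.
- by move=> eta _; apply: memvf.
- by rewrite memvf.
have := near_open_normal_cone theta0_open.
by apply: filterS => eta /open_normal_cone_sub.
Qed.

Lemma relint_normal_cone : relint sigma = open_sigma.
Proof.
apply/seteqP; split=> theta.
  move=> [st near_st] u uP uv.
  have [e e0] := near_ray (- theta0) near_st.
  rewrite lin_span_normal_cone => /(_ I)/(_ u uP).
  rewrite -subr_ge0 -pairingBr pairingDl pairingZl pairingNl mulrN subr_ge0.
  rewrite -subr_gt0 -pairingBr; apply: lt_le_trans.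
  by rewrite mulr_gt0 // pairingBr subr_gt0 theta0_open.
move=> o; split; first exact: open_normal_cone_sub.
have := near_open_normal_cone o.
by apply: filterS => eta /open_normal_cone_sub.
Qed.

Lemma normal_cone_dim : has_dim sigma n.
Proof.
exists fullv; rewrite lin_span_normal_cone dim_fullv_dual; split=> //.
by apply/seteqP; split=> // eta _; apply: memvf.
Qed.

(** If theta is an interior point at which a functional w, nonnegative on the
    cone, vanishes, then w is nonnegative in all directions, hence zero. *)
Lemma pairing_open_gt0 w theta : (forall eta, sigma eta -> 0 <= pairing eta w) ->
  w != 0 -> open_sigma theta -> 0 < pairing theta w.
Proof.
move=> w0 wn0 o; rewrite lt_neqAle w0 ?andbT; last exact: open_normal_cone_sub.
rewrite eq_sym; apply: contraNneq wn0 => theta_w.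
have dw d : 0 <= pairing d w.
  have [e e0 /open_normal_cone_sub/w0] := near_ray d (near_open_normal_cone o).
  by rewrite pairingDl theta_w add0r pairingZl pmulr_rge0.
apply/eqP/pairing_inj => d; rewrite pairing0r; apply/eqP.
by rewrite eq_le dw andbT -oppr_ge0 -pairingNl dw.
Qed.

(** A facet spans a hyperplane and theta0 lies outside of it, so that a vector
    orthogonal to the facet is determined by its value at theta0. *)
Lemma facet_normal tau : Facet sigma tau -> exists w,
  [/\ tau = sigma `&` [set theta | pairing theta w = 0], w != 0,
      forall theta, sigma theta -> 0 <= pairing theta w
    & forall x, (forall theta, tau theta -> pairing theta x = 0) ->
      x = (pairing theta0 x / pairing theta0 w) *: w].
Proof.
move=> [[w [w0 tauE]] [k [[U1 [spanU1 dimU1]] [U2 [spanU2 dimU2]]]]].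
have U1T : U1 = fullv.
  apply/vspaceP => theta; rewrite memvf.
  have : [set eta : dual | eta \in U1] theta.
    by rewrite -spanU1 lin_span_normal_cone.
  by [].
have wn0 : w != 0.
  apply/eqP => w_eq0; have tau_sigma : tau = sigma.
    rewrite tauE; apply/seteqP; split=> [theta []//|theta st]; split=> //=.
    by rewrite w_eq0 pairing0r.
  have : U1 = U2.
    apply/vspaceP => theta; have : [set eta : dual | eta \in U1] theta
      = [set eta : dual | eta \in U2] theta.
      by rewrite -spanU1 -spanU2 tau_sigma.
    by move=> /= e; apply/idP/idP; rewrite e.
  by move=> U12; have := n_Sn k; rewrite -dimU1 -dimU2 U12.
have w_gt0 := pairing_open_gt0 w0 wn0 theta0_open.
have kill x : (forall theta, tau theta -> pairing theta x = 0) ->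
    (U2 <= hyperplane x)%VS.
  move=> x0; apply/subvP => theta theta_U2.
  apply: (@lin_span_sub tau); last by rewrite spanU2.
  by move=> eta /x0 e; rewrite mem_hyperplane e.
have full : (U2 + <[theta0]>)%VS = fullv.
  apply/eqP; rewrite eqEdim subvf -U1T dimU1 -dimU2 ltnNge /=.
  apply/negP => le_dim; have /subvP/(_ theta0) : (U2 + <[theta0]> <= U2)%VS.
    by rewrite -(geq_leqif (dimv_leqif_sup (addvSl U2 <[theta0]>))).
  rewrite (subvP (addvSr _ _)) ?memv_line // => /(_ isT) theta0_U2.
  have /subvP/(_ _ theta0_U2) : (U2 <= hyperplane w)%VS.
    by apply: kill => theta; rewrite tauE => -[].
  by rewrite mem_hyperplane gt_eqF.
exists w; split=> // x x0; apply: pairing_inj => theta.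
have : theta \in (U2 + <[theta0]>)%VS by rewrite full memvf.
case/memv_addP => a aU2 [_ /vlineP[c ->] ->].
rewrite !pairingDl !pairingZl !pairingZr divfK ?gt_eqF //; congr (_ + _).
have := subvP (kill x x0) a aU2; rewrite mem_hyperplane => /eqP ->.
have /subvP/(_ a aU2) : (U2 <= hyperplane w)%VS.
  by apply: kill => eta; rewrite tauE => -[].
by rewrite mem_hyperplane => /eqP ->; rewrite mulr0.
Qed.

(** A face on which finitely many inequalities are never simultaneously strict
    lies in one of their boundary hyperplanes: otherwise add up points at
    which the various inequalities are strict. *)
Lemma face_covering tau w s : tau = sigma `&` [set theta | pairing theta w = 0] ->
  {subset s <= P} ->
  (forall theta, tau theta -> exists2 u, u \in s & pairing theta u = pairing theta v) ->
  exists2 u, u \in s & forall theta, tau theta -> pairing theta (v - u) = 0.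
Proof.
move=> tauE sP cover; apply: contrapT => no_u.
suff [theta ttheta lt_s] : exists2 theta, tau theta &
    forall u, u \in s -> pairing theta u < pairing theta v.
  by have [u /lt_s lt_u eq_u] := cover _ ttheta; rewrite eq_u ltxx in lt_u.
have strict u : u \in s -> exists2 theta, tau theta & pairing theta u < pairing theta v.
  move=> us; apply: contrapT => nlt; apply: no_u; exists u => // theta ttheta.
  apply/eqP; rewrite pairingBr subr_eq0 eq_le; apply/andP; split.
    by rewrite leNgt; apply/negP => lt_u; apply: nlt; exists theta.
  by move: ttheta; rewrite tauE => -[st _]; apply/st/sP.
have tau0 : tau 0 by rewrite tauE; split; [apply: normal_cone0|rewrite /= pairing0l].
have tauD a b : tau a -> tau b -> tau (a + b).
  rewrite tauE => -[sa /= a0] [sb /= b0]; split; first exact: normal_coneD.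
  by rewrite /= pairingDl a0 b0 addr0.
elim: s sP strict {cover no_u} => [|u s IH] sP strict; first by exists 0.
have [||a ta lt_a] := IH.
- by move=> x xs; apply: sP; rewrite inE xs orbT.
- by move=> x xs; apply: strict; rewrite inE xs orbT.
have [b tb lt_b] := strict u (mem_head _ _).
exists (a + b); first exact: tauD.
move: (ta) (tb); rewrite tauE => -[sa _] [sb _] x; rewrite !pairingDl inE => /predU1P[->|xs].
  by rewrite ler_ltD // sa // sP // mem_head.
by rewrite ltr_leD ?lt_a // sb // sP // inE xs orbT.
Qed.

(** An irredundant generator g of the dual cone defines a facet: a functional
    separating g from the other generators, moved towards theta0 until it
    vanishes at g, is positive on all other generators, hence is an interior
    point of the face relative to the hyperplane of g. *)
Lemma irredundant_facet s g : (forall h, h \in s -> 0 < pairing theta0 h) ->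
  (forall theta, sigma theta <-> forall h, h \in s -> 0 <= pairing theta h) ->
  g \in s -> ~ cone_hull (rem g s) g ->
  Facet sigma (sigma `&` [set theta | pairing theta g = 0]).
Proof.
move=> s_gt0 sigmaE gs irr; have g_gt0 := s_gt0 g gs.
have gn0 : g != 0.
  by apply: contraTneq g_gt0 => ->; rewrite pairing0r ltxx.
split; first by exists g; split=> // theta /sigmaE; apply.
exists (\dim (hyperplane g)); rewrite (dim_hyperplane gn0).
split; first exact: normal_cone_dim.
exists (hyperplane g); split=> //.
have [[eta [eta_g eta_s]]|//] := farkas (rem g s) g.
(* With this coefficient eta + e *: theta0 vanishes at g. *)
pose e := - pairing eta g / pairing theta0 g.
have e0 : 0 < e by rewrite divr_gt0 // oppr_gt0.
pose theta := eta + e *: theta0.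
have theta_g : pairing theta g = 0.
  by rewrite pairingDl pairingZl divfK ?gt_eqF // addrN.
have theta_s h : h \in rem g s -> 0 < pairing theta h.
  move=> hs; rewrite pairingDl pairingZl ltr_wpDl ?eta_s // mulr_gt0 // s_gt0 //.
  exact: mem_rem hs.
apply: (@lin_span_relopen _ _ theta).
- by move=> y [_ /= yg]; rewrite mem_hyperplane yg.
- by rewrite mem_hyperplane theta_g.
apply: filterS (near_pairing_gt0 theta_s) => y y_gt0.
rewrite mem_hyperplane => /eqP yg; split=> //; apply/sigmaE => h hs.
have [->|hg] := eqVneq h g; first by rewrite yg.
by rewrite ltW // y_gt0 //; move: hs; rewrite (perm_mem (perm_to_rem gs)) inE (negPf hg).
Qed.

Section Walls.
Variables Q Q' : set V.
Hypotheses (coneQ : convex_cone Q) (coneQ' : convex_cone Q').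
Hypothesis QQ'_pointed : forall x, Q x -> Q' x -> x = 0.
Hypothesis boundary_walls : forall theta u, sigma theta -> u \in P -> u != v ->
  pairing theta u = pairing theta v -> wall Q P v theta \/ wall Q' P v theta.

(** A facet in the wall of T lies in one hyperplane theta(v - u) = 0 with v - u
    in T, and v - u is a positive multiple of the normal. *)
Lemma wall_facet_normal (T : set V) tau w : convex_cone T ->
  tau = sigma `&` [set theta | pairing theta w = 0] ->
  0 < pairing theta0 w ->
  (forall x, (forall theta, tau theta -> pairing theta x = 0) ->
    x = (pairing theta0 x / pairing theta0 w) *: w) ->
  tau `<=` wall T P v -> T w.
Proof.
move=> [_ _ TZ] tauE w_gt0 tau_perp tauT.
pose s := [seq u <- P | (u != v) && `[< T (v - u) >]].
have [|theta /tauT [_ [u [uP uv Tu e]]]|u us tau_u] := face_covering (s := s) tauE.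
- by move=> u; rewrite mem_filter => /andP[].
- by exists u => //; rewrite mem_filter uv uP andbT; apply/asboolP.
move: us; rewrite mem_filter => /andP[/andP[uv /asboolP Tu] uP].
have u_gt0 : 0 < pairing theta0 (v - u) by rewrite pairingBr subr_gt0 theta0_open.
have -> : w = (pairing theta0 w / pairing theta0 (v - u)) *: (v - u).
  rewrite [X in _ *: X](tau_perp _ tau_u) scalerA mulrA divfK ?gt_eqF //.
  by rewrite mulfV ?scale1r // gt_eqF.
by apply: TZ => //; rewrite ltW // divr_gt0.
Qed.

(** A facet contains no interior point of the cone, so that it is covered by
    the two walls, hence by a single hyperplane taken from one of them; it is
    not in both since its normal would be in Q and in Q'. *)
Lemma facet_dichotomy tau : Facet sigma tau ->
  (tau `<=` wall Q P v \/ tau `<=` wall Q' P v) /\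
  ~ (tau `<=` wall Q P v /\ tau `<=` wall Q' P v).
Proof.
move=> /facet_normal [w [tauE wn0 w0 tau_perp]].
have w_gt0 := pairing_open_gt0 w0 wn0 theta0_open.
split; last first.
  move=> [tQ tQ']; move/eqP: wn0; apply; apply: QQ'_pointed.
    exact: wall_facet_normal coneQ tauE w_gt0 tau_perp tQ.
  exact: wall_facet_normal coneQ' tauE w_gt0 tau_perp tQ'.
pose s := [seq u <- P | (u != v) && `[< Q (v - u) \/ Q' (v - u) >]].
have [||u us tau_u] := face_covering (s := s) tauE.
- by move=> u; rewrite mem_filter => /andP[].
- move=> theta; rewrite tauE => -[st /= theta_w].
  have [u [uP uv e]] : exists u,
      [/\ u \in P, u != v & pairing theta u = pairing theta v].
    apply: contrapT => no_u; have o : open_sigma theta.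
      move=> u uP uv; rewrite lt_neqAle st // andbT.
      by apply/eqP => e; apply: no_u; exists u.
    by have := pairing_open_gt0 w0 wn0 o; rewrite theta_w ltxx.
  have [[_ [u' [u'P u'v Qu' e']]]|[_ [u' [u'P u'v Qu' e']]]] :=
    boundary_walls st uP uv e; exists u' => //;
    rewrite mem_filter u'v u'P andbT; apply/asboolP.
    by left.
  by right.
move: us; rewrite mem_filter => /andP[/andP[uv /asboolP Qu] uP].
have eq_u theta : tau theta -> pairing theta u = pairing theta v.
  by move=> /tau_u/eqP; rewrite pairingBr subr_eq0 => /eqP ->.
have tau_sigma theta : tau theta -> sigma theta by rewrite tauE => -[].
case: Qu => Qu; [left|right] => theta ttheta; split; try exact: tau_sigma;
  by exists u; split=> //; apply: eq_u.
Qed.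

(** If theta(u) = theta(v), then v - u is a nonnegative combination of those
    irredundant generators of the dual cone which vanish at theta; if the
    facets of these generators were all in the other wall, v - u would be in
    Q' as well. *)
Lemma wall_facets :
  wall Q P v = \bigcup_(tau in [set tau | Facet sigma tau /\ tau `<=` wall Q P v]) tau.
Proof.
apply/seteqP; split=> [theta [st [u [uP uv Qu e]]]|theta [tau [_ tauQ] /tauQ //]].
pose s0 := [seq v - u | u <- P & u != v].
have [s [ss0 gen irr]] := irredundant_generators s0.
have s0_gt0 h : h \in s0 -> 0 < pairing theta0 h.
  move=> /mapP[u' + ->]; rewrite mem_filter => /andP[uv' uP'].
  by rewrite pairingBr subr_gt0 theta0_open.
have s_gt0 h : h \in s -> 0 < pairing theta0 h by move=> /ss0/s0_gt0.
have s0_mem u' : u' \in P -> u' != v -> v - u' \in s0.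
  by move=> uP' uv'; apply: map_f; rewrite mem_filter uv'.
have sigmaE eta : sigma eta <-> forall h, h \in s -> 0 <= pairing eta h.
  split=> [se h /ss0/mapP[u' + ->]|s_ge0 u' uP'].
    rewrite mem_filter => /andP[uv' uP'].
    by rewrite pairingBr subr_ge0 se.
  have [->//|uv'] := eqVneq u' v; rewrite -subr_ge0 -pairingBr.
  exact: cone_hull_ge0 s_ge0 (gen _ (s0_mem _ uP' uv')).
apply: contrapT => not_covered.
have Q's h : h \in s -> pairing theta h = 0 -> Q' h.
  move=> hs theta_h; have fh := irredundant_facet s_gt0 sigmaE hs (irr h hs).
  set tau := sigma `&` _ in fh.
  have [[tQ|tQ'] _] := facet_dichotomy fh.
    by case: not_covered; exists tau.
  have [w [tauE wn0 w0 tau_perp]] := facet_normal fh.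
  have w_gt0 := pairing_open_gt0 w0 wn0 theta0_open.
  have [_ _ Q'Z] := coneQ'.
  rewrite (tau_perp h); last by move=> eta [].
  apply: Q'Z; first by rewrite divr_ge0 // ltW // s_gt0.
  exact: wall_facet_normal coneQ' tauE w_gt0 tau_perp tQ'.
(* Membership in this convex cone passes from the generators to v - u: a sum
   of nonnegative values vanishes only if each of them does. *)
pose K := [set y | 0 <= pairing theta y /\ (pairing theta y = 0 -> Q' y)].
have coneK : convex_cone K.
  have [Q'0 Q'D Q'Z] := coneQ'; split.
  - by split=> //; rewrite pairing0r.
  - move=> x y [x0 Qx] [y0 Qy]; split; first by rewrite pairingDr addr_ge0.
    move=> /eqP; rewrite pairingDr paddr_eq0 // => /andP[/eqP xe /eqP ye].
    by apply: Q'D; [apply: Qx|apply: Qy].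
  move=> a x a0 [x0 Qx]; split; first by rewrite pairingZr mulr_ge0.
  move=> /eqP; rewrite pairingZr mulf_eq0 => /orP[/eqP ->|/eqP xe].
    by rewrite scale0r.
  by apply: Q'Z => //; apply: Qx.
have [_ Q'u] : K (v - u).
  apply: (gen _ (s0_mem u uP uv) K coneK) => h hs; split; last exact: Q's.
  by have /sigmaE := st; apply.
move/eqP: uv; apply; apply/esym/subr0_eq; apply: QQ'_pointed => //.
by apply: Q'u; rewrite pairingBr e subrr.
Qed.

(** The difference of the vertices of two adjacent normal cones is orthogonal
    to the common facet and positive at theta0, hence a positive multiple of
    the normal of the facet. *)
Lemma adjacent_vertex v' : v \in P -> v' \in P ->
  Facet sigma (sigma `&` normal_cone P v') ->
  v' != v /\ (sigma `&` normal_cone P v' `<=` wall Q P v -> Q (v - v')).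
Proof.
move=> vP v'P ft; have [w [tauE wn0 w0 tau_perp]] := facet_normal ft.
have w_gt0 := pairing_open_gt0 w0 wn0 theta0_open.
have vv' : v' != v.
  apply: contraTneq w_gt0 => v'v.
  have : (sigma `&` normal_cone P v') theta0.
    by rewrite v'v; split; apply: open_normal_cone_sub.
  by rewrite tauE => -[_ /= ->]; rewrite ltxx.
split=> // tQ; have [_ _ QZ] := coneQ.
have x_gt0 : 0 < pairing theta0 (v - v').
  by rewrite pairingBr subr_gt0 theta0_open.
rewrite (tau_perp (v - v')); last first.
  move=> theta [st st']; apply/eqP.
  by rewrite pairingBr subr_eq0 eq_le st' ?st.
apply: QZ; first by rewrite divr_ge0 // ltW.
exact: wall_facet_normal coneQ tauE w_gt0 tau_perp tQ.
Qed.
End Walls.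
End NormalCone.
End ConvexCones.

(** * Subobjects maximizing a functional *)

Section Maximizers.
Variables (R : realType) (n : nat) (A : length_cat n) (M : A).
Implicit Types (X N L C I : A) (U V W : subobject M) (theta eta : K0dual R n).
Local Notation cl U := (@K0class R n A (sub_dom U)).

Definition maximizer theta U := forall V, pairing theta (cl V) <= pairing theta (cl U).

Lemma maximizer_class theta U V : cl U = cl V -> maximizer theta U -> maximizer theta V.
Proof. by move=> UV mU W; rewrite -UV. Qed.

Lemma maximizer_value theta U V :
  maximizer theta U -> maximizer theta V ->
  pairing theta (cl U) = pairing theta (cl V).
Proof. by move=> mU mV; apply/eqP; rewrite eq_le mU mV. Qed.

Lemma maximizer_Tbar theta U : maximizer theta U -> Tbar theta (sub_dom U).
Proof.
move=> mU N p /sub_of_quotient-/(_ R)[L _ UL].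
by have := mU L; rewrite UL pairingDr lerDl.
Qed.

Lemma maximizer_coker theta U C (c : hom M C) L (l : hom L C) :
  maximizer theta U -> is_cokernel (sub_arr U) c -> is_mono l ->
  value theta L <= 0.
Proof.
move=> mU cc ml; have [W _ WU] := sub_of_sub_coker R cc ml.
by have := mU W; rewrite WU pairingDr gerDl.
Qed.

Definition sub_classes : seq (K0 R n) := sval (cid (sub_classes_finite R M)).

Lemma sub_classesP u : u \in sub_classes <-> exists U, u = cl U.
Proof. by rewrite /sub_classes; case: (cid _) => P /= ->. Qed.

Lemma sub_class_mem U : cl U \in sub_classes.
Proof. by apply/sub_classesP; exists U. Qed.

Lemma seq_argmax (T : eqType) (s : seq T) (f : T -> R) x0 : x0 \in s ->
  exists2 x, x \in s & forall y, y \in s -> f y <= f x.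
Proof.
elim: s x0 => // a s IH x0 _; case: s IH => [_|b s IH].
  by exists a; rewrite ?mem_head // => y; rewrite inE => /eqP ->.
have [x xs fx] := IH b (mem_head _ _).
have [le_xa|lt_ax] := leP (f x) (f a).
  exists a; first exact: mem_head.
  by move=> y; rewrite inE => /predU1P[->//|/fx/le_trans]; apply.
exists x; first by rewrite inE xs orbT.
by move=> y; rewrite inE => /predU1P[->|/fx//]; apply: ltW.
Qed.

(** A second functional is maximized among the maximizers of theta, which have
    finitely many classes; it selects maximizers of extremal length. *)
Lemma maximizer_exists theta eta : exists2 U, maximizer theta U &
  forall V, maximizer theta V -> pairing eta (cl V) <= pairing eta (cl U).
Proof.
have [u us max_u] := seq_argmax (pairing theta) (sub_class_mem (Subobject (@idm_mono _ M))).
have /sub_classesP[U0 uU0] := us.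
pose s := [seq v <- sub_classes | pairing theta v == pairing theta u].
have us' : u \in s by rewrite mem_filter eqxx us.
have [v + max_v] := seq_argmax (pairing eta) us'.
rewrite mem_filter => /andP[/eqP vu /sub_classesP[U vU]].
exists U; first by move=> V; rewrite -vU vu max_u // sub_class_mem.
move=> V mV; rewrite -vU; apply: max_v.
rewrite mem_filter sub_class_mem andbT uU0; apply/eqP/maximizer_value => //.
by move=> W; rewrite -uU0 max_u // sub_class_mem.
Qed.

(** The functional with value 1 on each simple object: its value is the length. *)
Definition length_functional : K0dual R n := const_mx 1.

Lemma length_eq0 X : pairing length_functional (K0class R X) <= 0 -> is_zero X.
Proof.
have -> : pairing length_functional (K0class R X) = \sum_j K0class R X 0 j.
  by rewrite /pairing mxE; apply: eq_bigr => j _; rewrite [const_mx _ _ _]mxE mulr1.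
move=> le0; apply: (@K0class_eq0 R); apply/rowP => j; rewrite [RHS]mxE.
have ge0 i : true -> 0 <= K0class R X 0 i by move=> _; apply: K0class_ge0.
by apply: (psumr_eq0P ge0) => //; apply/eqP; rewrite eq_le le0 sumr_ge0.
Qed.

(** A maximizer B of maximal length contains every subobject V in
    Tbar: the image I of V in M/B has nonnegative value, so that the preimage
    of I in M is again a maximizer, whence I = 0. *)
Lemma largest_Tbar theta :
  exists2 B, is_largest_sub (Tbar theta) B & maximizer theta B.
Proof.
have [B mB maxB] := maximizer_exists theta length_functional; exists B => //.
split=> [|V TV]; first exact: maximizer_Tbar.
have [C [c cc]] := has_cokernel (sub_arr B).
have [I [e [m [ee mm]]]] := sub_image V cc; apply.
have [W _ WB] := sub_of_sub_coker R cc mm.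
have /maxB : maximizer theta W.
  by move=> V'; apply: le_trans (mB V') _; rewrite WB pairingDr lerDl; apply: TV ee.
by rewrite WB pairingDr gerDl => /length_eq0.
Qed.

(** Let S be a maximizer of minimal length. A quotient of S of value 0 vanishes
    since its kernel is another maximizer, so S lies in T. If V lies in T and
    U is a maximizer, then the image of V in M/U has nonpositive value, hence
    vanishes; this applies to U = S and to V = S. *)
Lemma largest_Tcat theta : exists S,
  [/\ is_largest_sub (Tcat theta) S, maximizer theta S
    & forall U, maximizer theta U -> sub_le S U].
Proof.
have [S mS maxS] := maximizer_exists theta (- length_functional); exists S.
have sub_max V U : Tcat theta (sub_dom V) -> maximizer theta U -> sub_le V U.
  move=> TV mU; have [C [c cc]] := has_cokernel (sub_arr U).
  have [I [e [m [ee mm]]]] := sub_image V cc; apply.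
  apply: contrapT => /(TV _ _ ee).
  by rewrite ltNge (maximizer_coker mU cc mm).
have TS : Tcat theta (sub_dom S).
  move=> N p ep N0; have [L _ LS] := sub_of_quotient R ep.
  rewrite lt_neqAle (maximizer_Tbar mS ep) andbT eq_sym.
  apply/eqP => N_eq0; apply: N0; apply: length_eq0.
  have /maxS : maximizer theta L.
    by move=> V; apply: le_trans (mS V) _; rewrite LS pairingDr -/(value theta N) N_eq0 addr0.
  by rewrite !pairingNl lerN2 LS pairingDr gerDl.
by split=> // [|U]; [split=> // V TV; apply: sub_max|apply: sub_max].
Qed.

Lemma largest_subP (Pr : A -> Prop) U :
  is_largest_sub Pr U -> is_largest_sub Pr (largest_sub Pr M).
Proof. by rewrite /largest_sub => hU; case: xgetP => // /(_ U). Qed.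

Lemma largest_sub_eq (Pr : A -> Prop) U V :
  is_largest_sub Pr U -> is_largest_sub Pr V -> sub_eq U V.
Proof. by move=> [PU maxU] [PV maxV]; split; [apply: maxV|apply: maxU]. Qed.

Lemma tbar_subP theta : maximizer theta (tbar_sub theta M) /\
  forall U, maximizer theta U -> sub_le U (tbar_sub theta M).
Proof.
have [B lB mB] := largest_Tbar theta; have lT := largest_subP lB.
split; first by apply: maximizer_class mB; apply/sub_eq_class/(largest_sub_eq lB).
by move=> U /maximizer_Tbar; apply: lT.2.
Qed.

Lemma t_subP theta : maximizer theta (t_sub theta M) /\
  forall U, maximizer theta U -> sub_le (t_sub theta M) U.
Proof.
have [S [lS mS minS]] := largest_Tcat theta; have lT := largest_subP lS.
have [ST TS] := largest_sub_eq lS lT.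
split=> [|U /minS SU]; last exact: sub_le_trans TS SU.
by apply: maximizer_class mS; apply/sub_eq_class.
Qed.

(** ** Full-dimensional TF equivalence classes *)

Local Notation P := sub_classes.

Lemma normal_cone_maximizer theta U :
  normal_cone P (cl U) theta -> maximizer theta U.
Proof. by move=> nU V; apply/nU/sub_class_mem. Qed.

Lemma open_normal_cone_torsion theta U : open_normal_cone P (cl U) theta ->
  sub_eq (t_sub theta M) U /\ sub_eq (tbar_sub theta M) U.
Proof.
move=> o; have mU := normal_cone_maximizer (open_normal_cone_sub o).
have unique V : maximizer theta V -> cl V = cl U.
  move=> mV; apply/eqP/negPn/negP => /(o _ (sub_class_mem V)).
  by rewrite (maximizer_value mV mU) ltxx.
have [[mt tmin] [mtb tbmax]] := (t_subP theta, tbar_subP theta).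
split; first by apply: (@sub_le_eq R) (unique _ mt); apply: tmin.
by apply/sub_eq_sym/(@sub_le_eq R); [apply: tbmax|rewrite unique].
Qed.

Lemma open_normal_cone_w theta U : open_normal_cone P (cl U) theta ->
  is_zero (w_obj theta M).
Proof.
move=> o; apply: coker_iso_zero; have [tU tbU] := open_normal_cone_torsion o.
have [tt _] := sub_eq_trans tU (sub_eq_sym tbU).
apply: (@sub_le_class_eq R) => //.
by rewrite (sub_eq_class R tU) (sub_eq_class R tbU).
Qed.

(** TF equivalence requires the supports of w_theta M and w_eta M to agree, which
    is automatic once both objects vanish. *)
Lemma supp_zero theta X : is_zero X -> supp theta X = set0.
Proof.
move=> X0; apply/seteqP; split=> // S [hX [hS]]; apply: comp_factor_zero.
by move=> Y; split=> f; [exact: (@from_zero A X (sval Y) f)|exact: (@to_zero A (sval Y) X f)].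
Qed.

(** The value of w_theta M vanishes on the whole TF equivalence class; if the
    class spans the dual space, then w_theta M = 0, so that the maximizer is
    unique and constant on the class. *)
Lemma TF_class_normal_cone theta :
  lin_span (closure [set eta | TF_equiv M theta eta]) = setT ->
  [set eta | TF_equiv M theta eta] = open_normal_cone P (cl (t_sub theta M)).
Proof.
set E := [set eta | _] => spanE.
set T := t_sub theta M; set TB := tbar_sub theta M.
have TTB : cl T = cl TB.
  apply/subr0_eq; set x := _ - _.
  have E0 eta : E eta -> pairing eta x = 0.
    move=> [tt tb _]; rewrite pairingBr; apply/eqP; rewrite subr_eq0; apply/eqP.
    rewrite (sub_eq_class R tt) (sub_eq_class R tb).
    by apply: maximizer_value; [have [] := t_subP eta|have [] := tbar_subP eta].
  have cE0 eta : closure E eta -> eta \in hyperplane x.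
    move=> cE; rewrite mem_hyperplane eq_le; apply/andP; split; last first.
      by apply: closure_pairing_ge0 cE => y /E0 ->.
    rewrite -oppr_ge0 -mulN1r -pairingZr.
    by apply: closure_pairing_ge0 cE => y /E0; rewrite pairingZr => ->; rewrite mulr0.
  apply: pairing_inj => eta; rewrite pairing0r; apply/eqP.
  by rewrite -mem_hyperplane; apply: (lin_span_sub cE0); rewrite spanE.
have E_open eta : E eta -> open_normal_cone P (cl T) eta.
  move=> [tt tb _] u /sub_classesP[U ->] UT.
  have [[mt tmin] [mtb tbmax]] := (t_subP eta, tbar_subP eta).
  have et := sub_eq_class R tt; have eb := sub_eq_class R tb.
  rewrite -/T in et; rewrite -/TB in eb.
  rewrite lt_neqAle {2}et mt andbT; apply: contra UT => /eqP e.
  have mU : maximizer eta U by move=> V; rewrite e et; apply: mt.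
  apply/eqP/rowP => j; apply/eqP; rewrite eq_le; apply/andP; split.
    by rewrite TTB eb; apply/sub_le_class/tbmax.
  by rewrite et; apply/sub_le_class/tmin.
have o0 : open_normal_cone P (cl T) theta.
  by apply: E_open; split=> //; split; exists (idm _); rewrite compm1.
apply/seteqP; split=> [|eta o]; first exact: E_open.
have [[tT tbT] [tT0 tbT0]] :=
  (open_normal_cone_torsion o, open_normal_cone_torsion o0).
split; [exact: sub_eq_trans tT0 (sub_eq_sym tT)
  |exact: sub_eq_trans tbT0 (sub_eq_sym tbT)|].
by rewrite !supp_zero //; apply: open_normal_cone_w; [exact: o|exact: o0].
Qed.

Lemma Sigma_max_normal_cone sigma : Sigma_max M sigma -> exists U theta,
  open_normal_cone P (cl U) theta /\ sigma = normal_cone P (cl U).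
Proof.
move=> [[theta sigmaE] [D [spanD dimD]]].
have span_sigma : lin_span sigma = setT.
  rewrite spanD; apply/seteqP; split=> // eta _ /=.
  suff -> : D = fullv by apply: memvf.
  by apply/eqP; rewrite eqEdim subvf dimD dim_fullv_dual /=.
rewrite sigmaE in span_sigma; have TFE := TF_class_normal_cone span_sigma.
exists (t_sub theta M), theta.
have o : open_normal_cone P (cl (t_sub theta M)) theta.
  by rewrite -TFE; split=> //; split; exists (idm _); rewrite compm1.
by split=> //; rewrite sigmaE TFE (closure_open_normal_cone o).
Qed.

(** Values of theta on the Newton polytope are convex combinations of values on
    P, so that the class of U is a maximum of theta on the polytope. *)
Lemma vertex_of_normal_cone U theta v : open_normal_cone P (cl U) theta ->
  vertex_of M (normal_cone P (cl U)) v -> v = cl U.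
Proof.
move=> o [_ /(_ theta)]; rewrite (relint_normal_cone o) => /(_ o) faceE.
suff : max_face (newton M) theta (cl U) by rewrite faceE.
split.
  exists 1%N, (fun=> cl U), (fun=> 1); split=> //.
  - by move=> _; exists U.
  - by rewrite big_ord1.
  by rewrite big_ord1 scale1r.
move=> _ [k [x [a [xP a0 a1 ->]]]].
have -> : pairing theta (\sum_i a i *: x i) = \sum_i a i * pairing theta (x i).
  have pD := pairingDr theta; have p0 := pairing0r theta.
  rewrite (big_morph _ pD p0).
  by apply: eq_bigr => i _; rewrite pairingZr.
rewrite -[leRHS]mul1r -a1 mulr_suml; apply: ler_sum => i _.
apply: ler_wpM2l => //; have [V ->] := xP i.
exact: open_normal_cone_sub o _ (sub_class_mem V).
Qed.

(** ** The boundary of the normal cone *)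

Definition nonneg : set (K0 R n) := [set x | forall j, 0 <= x 0 j].
Definition nonpos : set (K0 R n) := [set x | forall j, x 0 j <= 0].

Lemma convex_cone_nonneg : convex_cone nonneg.
Proof.
split=> [j|x y x0 y0 j|a x a0 x0 j]; rewrite ?mxE ?addr_ge0 ?x0 ?y0 //.
by rewrite mulr_ge0.
Qed.

Lemma convex_cone_nonpos : convex_cone nonpos.
Proof.
split=> [j|x y x0 y0 j|a x a0 x0 j]; rewrite !mxE //.
  by rewrite -oppr_ge0 opprD addr_ge0 // oppr_ge0 ?x0 ?y0.
by rewrite mulr_ge0_le0.
Qed.

Lemma nonneg_nonpos0 x : nonneg x -> nonpos x -> x = 0.
Proof.
move=> ge0 le0; apply/rowP => j; apply/eqP.
by rewrite mxE eq_le ge0 le0.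
Qed.

Lemma nonneg_subP x y : nonneg (x - y) <-> forall j, y 0 j <= x 0 j.
Proof. by split=> h j; have := h j; rewrite !mxE subr_ge0. Qed.

Lemma nonpos_subP x y : nonpos (x - y) <-> forall j, x 0 j <= y 0 j.
Proof. by split=> h j; have := h j; rewrite !mxE subr_le0. Qed.

Lemma sub_le_nonneg U V : sub_le U V -> nonneg (cl V - cl U).
Proof. by move=> UV; apply/nonneg_subP; apply: sub_le_class. Qed.

Lemma sub_le_nonpos U V : sub_le U V -> nonpos (cl U - cl V).
Proof. by move=> UV; apply/nonpos_subP; apply: sub_le_class. Qed.

(** A maximizer not contained in a maximizer U is separated from it by a
    common subquotient of value 0, namely its image in M/U. *)
Lemma maximizer_image theta U V C (c : hom M C) :
  maximizer theta U -> maximizer theta V -> is_cokernel (sub_arr U) c ->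
  ~ sub_le V U -> exists I (e : hom (sub_dom V) I) (m : hom I C),
  [/\ is_epi e, is_mono m, ~ is_zero I & value theta I = 0].
Proof.
move=> mU mV cc nVU; have [I [e [m [ee mm I0]]]] := sub_image V cc.
exists I, e, m; split=> //; first by move/I0.
by apply/eqP; rewrite eq_le (maximizer_coker mU cc mm) (maximizer_Tbar mV ee).
Qed.

(** A quotient of U of value 0 has a maximizer smaller than U as kernel.
    Conversely, if a maximizer V has a smaller class than U, then U is not
    contained in V and the image of U in M/V is a quotient of U of value 0. *)
Lemma not_TcatP theta U : normal_cone P (cl U) theta ->
  ~ Tcat theta (sub_dom U) <-> exists u, [/\ u \in P, u != cl U,
    nonneg (cl U - u) & pairing theta u = pairing theta (cl U)].
Proof.
move=> nU; have mU := normal_cone_maximizer nU; split.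
  move=> nT; apply: contrapT => no_u; apply: nT => N p ep N0.
  have [L LU UE] := sub_of_quotient R ep.
  rewrite lt_neqAle (maximizer_Tbar mU ep) andbT eq_sym; apply/eqP => N_eq0.
  apply: no_u; exists (cl L); split.
  - exact: sub_class_mem.
  - apply/eqP => LE; apply: N0; apply: (@K0class_eq0 R).
    by move: UE; rewrite LE -[LHS]addr0 => /addrI.
  - exact: sub_le_nonneg.
  by rewrite UE pairingDr -/(value theta N) N_eq0 addr0.
move=> [_ [/sub_classesP[V ->] VU geV e]] TU.
have mV : maximizer theta V by move=> W; rewrite e; apply: mU.
have [C [c cc]] := has_cokernel (sub_arr V).
have [UV|I [i [m [ei _ I0 vI]]]] := maximizer_image mV mU cc.
  move/eqP: VU; apply; apply/esym/subr0_eq/nonneg_nonpos0 => //.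
  exact: sub_le_nonpos.
by have := TU _ _ ei I0; rewrite vI ltxx.
Qed.

(** A subobject of M/U of value 0 has a maximizer larger than U as preimage in
    M. Conversely, if a maximizer V has a larger class than U, then its image
    in M/U is a subobject of value 0. *)
Lemma not_FcatP theta U : normal_cone P (cl U) theta ->
  ~ Fcat theta (coker (sub_arr U)) <-> exists u, [/\ u \in P, u != cl U,
    nonpos (cl U - u) & pairing theta u = pairing theta (cl U)].
Proof.
move=> nU; have mU := normal_cone_maximizer nU.
have [c cc] := coker_cokernel (sub_arr U); split.
  move=> nF; apply: contrapT => no_u; apply: nF => L l ml L0.
  have [W UW WE] := sub_of_sub_coker R cc ml.
  rewrite lt_neqAle (maximizer_coker mU cc ml) andbT; apply/eqP => L_eq0.
  apply: no_u; exists (cl W); split.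
  - exact: sub_class_mem.
  - apply/eqP => WU; apply: L0; apply: (@K0class_eq0 R).
    by move: WE; rewrite WU -[LHS]addr0 => /addrI.
  - exact: sub_le_nonpos.
  by rewrite WE pairingDr -/(value theta L) L_eq0 addr0.
move=> [_ [/sub_classesP[V ->] VU leV e]] FU.
have mV : maximizer theta V by move=> W; rewrite e; apply: mU.
have [VU'|I [i [m [_ mm I0 vI]]]] := maximizer_image mU mV cc.
  move/eqP: VU; apply; apply/esym/subr0_eq/nonneg_nonpos0 => //.
  exact: sub_le_nonneg.
by have := FU _ _ mm I0; rewrite vI ltxx.
Qed.

(** A further maximizer V contains U, or else U has a nonzero quotient of value
    0, namely its image in M/V. *)
Lemma boundary_walls theta U u : normal_cone P (cl U) theta ->
  u \in P -> u != cl U -> pairing theta u = pairing theta (cl U) ->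
  wall nonneg P (cl U) theta \/ wall nonpos P (cl U) theta.
Proof.
move=> nU /sub_classesP[V ->] VU e; have mU := normal_cone_maximizer nU.
have mV : maximizer theta V by move=> W; rewrite e; apply: mU.
have [C [c cc]] := has_cokernel (sub_arr V).
have [UV|nUV] := pselect (sub_le U V).
  right; split=> //; exists (cl V); split=> //; first exact: sub_class_mem.
  exact: sub_le_nonpos.
left; split=> //; apply/not_TcatP => // TU.
have [I [i [m [ei _ I0 vI]]]] := maximizer_image mV mU cc nUV.
by have := TU _ _ ei I0; rewrite vI ltxx.
Qed.

Section Walls.
Variables (U : subobject M) (theta0 : K0dual R n).
Hypothesis theta0_open : open_normal_cone P (cl U) theta0.
Local Notation sigma := (normal_cone P (cl U)).

Lemma int_point_torsion :
  cl (t_sub (int_point sigma) M) = cl U /\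
  cl (tbar_sub (int_point sigma) M) = cl U.
Proof.
have o : open_normal_cone P (cl U) (int_point sigma).
  rewrite -(relint_normal_cone theta0_open) /int_point.
  by case: xgetP => // /(_ theta0); rewrite (relint_normal_cone theta0_open).
have [tU tbU] := open_normal_cone_torsion o.
by rewrite (sub_eq_class R tU) (sub_eq_class R tbU).
Qed.

Lemma bd_plusE : bd_plus M sigma = wall nonneg P (cl U).
Proof.
rewrite /bd_plus /t_cone; have [tU _] := int_point_torsion.
move: (t_sub (int_point sigma) M) tU => T tU.
apply/seteqP; rewrite /wall -tU.
by split=> theta [st h]; split=> //; apply/(not_TcatP st).
Qed.

Lemma bd_minusE : bd_minus M sigma = wall nonpos P (cl U).
Proof.
rewrite /bd_minus /f_cone /f_obj; have [_ tU] := int_point_torsion.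
move: (tbar_sub (int_point sigma) M) tU => T tU.
apply/seteqP; rewrite /wall -tU.
by split=> theta [st h]; split=> //; apply/(not_FcatP st).
Qed.

End Walls.
End Maximizers.

Arguments nonneg {R n}.
Arguments nonpos {R n}.

(** * Facets and the boundary of a maximal cone *)

Theorem theorem1p8 (R : realType) (n : nat) (A : length_cat n) (M : A)
    (sigma : set (K0dual R n)) (v : K0 R n)
    (hsigma : Sigma_max M sigma) (hv : vertex_of M sigma v) :
  (* (a) *)
  (Facet sigma = Facet_plus M sigma `|` Facet_minus M sigma /\
   Facet_plus M sigma `&` Facet_minus M sigma = set0) /\
  (* (b) *)
  (bd_plus M sigma = \bigcup_(tau in Facet_plus M sigma) tau /\
   bd_minus M sigma = \bigcup_(tau in Facet_minus M sigma) tau) /\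
  (* (c) *)
  (forall (sigma' : set (K0dual R n)) (v' : K0 R n),
    Sigma_max M sigma' ->
    Facet sigma (sigma `&` sigma') ->
    vertex_of M sigma' v' ->
    let i := K0lt A v' v /\ Facet_plus M sigma (sigma `&` sigma') in
    let ii := K0lt A v v' /\ Facet_minus M sigma (sigma `&` sigma') in
    (i \/ ii) /\ ~ (i /\ ii)).
Proof.
have [U [theta0 [o sigmaE]]] := Sigma_max_normal_cone hsigma.
rewrite sigmaE in hv *; have vU := vertex_of_normal_cone o hv.
rewrite {}vU in hv *; rewrite /Facet_plus /Facet_minus (bd_plusE o) (bd_minusE o).
set P := sub_classes R M; set w := K0class R (sub_dom U).
have [cp cm] := (@convex_cone_nonneg R n, @convex_cone_nonpos R n).
have walls theta u (st : normal_cone P w theta) :=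
  @boundary_walls R n A M theta U u st.
have walls' theta u : normal_cone P w theta -> u \in P -> u != w ->
    pairing theta u = pairing theta w ->
    wall nonpos P w theta \/ wall nonneg P w theta.
  by move=> st uP uw e; case: (walls theta u st uP uw e); [right|left].
have pointed := @nonneg_nonpos0 R n.
have pointed' (x : K0 R n) : nonpos x -> nonneg x -> x = 0 by move=> le ge; exact: pointed.
have dich := facet_dichotomy o cp cm pointed walls.
split; [split|split; [split|]].
- apply/seteqP; split=> [tau ft|tau [[]|[]] //].
  by have [[t_wall|t_wall] _] := dich _ ft; [left|right].
- apply/seteqP; split=> // tau [[ft tp] [_ tm]].
  by have [_] := dich _ ft; apply.
- exact (wall_facets o cp cm pointed walls).
- exact (wall_facets o cm cp pointed' walls').
move=> sigma' v' hsigma' ft hv' /=.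
have [U' [theta0' [o' sigmaE']]] := Sigma_max_normal_cone hsigma'.
rewrite {}sigmaE' in ft hv' *; have vU' := vertex_of_normal_cone o' hv'.
split; last first.
  by move=> [[_ [_ tp]] [_ [_ tm]]]; have [_] := dich _ ft; apply.
have [wP w'P] := (sub_class_mem R U, sub_class_mem R U').
have [ne_p adj_p] := adjacent_vertex o cp wP w'P ft.
have [ne_m adj_m] := adjacent_vertex o cm wP w'P ft.
have [[t_wall|t_wall] _] := dich _ ft; [left|right].
  split; last by split.
  split; last by rewrite vU'; apply/eqP.
  by apply/K0leP/nonneg_subP; rewrite vU'; apply: adj_p.
split; last by split.
split; last by rewrite vU'; apply/eqP; rewrite eq_sym.
by apply/K0leP/nonpos_subP; rewrite vU'; apply: adj_m.
Qed.
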